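(* For every fixed integer $k\ge 1$ and every fixed $\alpha>0$, $$\frac{M_{n,k}}{\sqrt{2\log n}}\longrightarrow \gamma_k(\alpha^2)\qquad\text{in probability as } n\to\infty.$$
   Context: Fix $\alpha>0$. For every $n\ge k$, $A=(A_{ij})_{1\le i,j\le n}$ is a real symmetric random matrix with $A_{ij}=A_{ji}\sim N(0,1)$ for $1\le i<j\le n$ and $A_{ii}\sim N(0,\alpha^2)$ for $1\le i\le n$, all random variables on and above the diagonal being independent. For $S\subset[n]=\{1,\dots,n\}$, $A_S$ is the principal submatrix indexed by $S$, and $$M_{n,k}:=\max_{\|x\|_0\le k,\ \|x\|_2=1}x^\top A x=\max_{S\subset[n],\,1\le|S|\le k}\lambda_{\max}(A_S),$$ where $\|x\|_0$ is the number of nonzero coordinates of $x\in\mathbb R^n$. For $a>0$, an integer $m\ge1$, a real symmetric $m\times m$ matrix $B$ and $U\subset[m]$, put $$\mathcal I_{U,a}(B):=\frac1a\sum_{i\in U}B_{ii}^2+\sum_{i<j,\ i,j\in U}B_{ij}^2,$$ $$\mathcal K_m(a):=\{B=B^\top\in\mathbb R^{m\times m}:\ \mathcal I_{U,a}(B)\le|U|\text{ for every }\varnothing\ne U\subset[m]\},$$ and $\gamma_m(a):=\max_{B\in\mathcal K_m(a)}\lambda_{\max}(B)$ (the maximum exists since $\mathcal K_m(a)$ is compact). *)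

(* Defs.v *)
From HB Require Import structures.
From mathcomp Require Import all_boot all_order all_algebra.
From mathcomp Require Import all_classical all_reals all_analysis.
Import Order.TTheory GRing.Theory Num.Theory numFieldNormedType.Exports.

Set Implicit Arguments.
Unset Strict Implicit.
Unset Printing Implicit Defensive.

Local Open Scope classical_set_scope.
Local Open Scope ring_scope.

Section LinearAlgebra.
Variable R : realType.

Definition l0norm n (x : 'cV[R]_n) : nat := #|[pred i | x i ord0 != 0]|.

Definition l2norm n (x : 'cV[R]_n) : R := Num.sqrt (\sum_i x i ord0 ^+ 2).

Definition quad_form n (B : 'M[R]_n) (x : 'cV[R]_n) : R :=
  (x^T *m B *m x) ord0 ord0.

(* The three [sup]s below are maxima: for symmetric matrices of positive size
   (with k >= 1 in [sparse_max] and a > 0 in [gamma_max]) the sets are nonempty and compact.  Outside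
   these cases the values carry no meaning. *)

Definition sparse_max n (k : nat) (B : 'M[R]_n) : R :=
  sup [set quad_form B x | x in
        [set x : 'cV[R]_n | (l0norm x <= k)%N /\ l2norm x = 1]].

Definition lambda_max m (B : 'M[R]_m) : R := sup [set l : R | eigenvalue B l].

Definition energy m (a : R) (U : {set 'I_m}) (B : 'M[R]_m) : R :=
  a^-1 * (\sum_(i in U) B i i ^+ 2)
  + \sum_(i in U) \sum_(j in U | (i < j)%N) B i j ^+ 2.

Definition feasible m (a : R) : set 'M[R]_m :=
  [set B | B^T = B /\
    forall U : {set 'I_m}, (0 < #|U|)%N -> energy a U B <= #|U|%:R].

Definition gamma_max m (a : R) : R :=
  sup [set lambda_max B | B in feasible (m := m) a].

End LinearAlgebra.

Section Probability.
Context d (T : measurableType d) (R : realType) (P : probability T R).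

(* [normal_prob] is parametrized by the standard deviation.  The laws are
   compared on measurable sets only: the set functions are unconstrained
   elsewhere. *)
Definition has_normal_law (X : {RV P >-> R}) (m sigma : R) : Prop :=
  forall B : set R, measurable B ->
    distribution P X B = normal_prob m sigma B.

Definition mutually_independent (I : finType) (D : pred I)
    (X : I -> {RV P >-> R}) : Prop :=
  forall (J : {set I}) (B : I -> set R),
    (forall i, i \in J -> D i) ->
    (forall i, i \in J -> measurable (B i)) ->
    P (\bigcap_(i in [set i | i \in J]) (X i @^-1` B i)) =
      (\prod_(i in J) P (X i @^-1` B i))%E.

Definition gaussian_symmetric n (alpha : R)
    (A : 'I_n -> 'I_n -> {RV P >-> R}) : Prop :=
  [/\ forall i j w, A i j w = A j i w,
      forall i j : 'I_n, (i < j)%N -> has_normal_law (A i j) 0 1,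
      forall i, has_normal_law (A i i) 0 alpha &
      mutually_independent (fun ij : 'I_n * 'I_n => (ij.1 <= ij.2)%N)
        (fun ij => A ij.1 ij.2)].

Definition random_matrix n (A : 'I_n -> 'I_n -> {RV P >-> R}) (w : T)
  : 'M[R]_n := \matrix_(i, j) A i j w.

End Probability.

(* The n-th variable lives on its own probability space, no coupling between
   different n being assumed; this is meaningful since the limit is constant. *)
Definition cvg_in_probability (R : realType) (d : nat -> measure_display)
    (T : forall n, measurableType (d n)) (P : forall n, probability (T n) R)
    (X : forall n, T n -> R) (l : R) : Prop :=
  forall eps : R, 0 < eps ->
    (fun n => P n [set w | eps <= `|X n w - l|]) @ \oo --> (0%:E : \bar R).

(* Main.v *)
Require Import Defs.
From HB Require Import structures.
From mathcomp Require Import all_boot all_order all_algebra.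
From mathcomp Require Import all_classical all_reals all_analysis.
From mathcomp Require Import measurable_realfun ring lra.
Import Order.TTheory GRing.Theory Num.Theory numFieldNormedType.Exports.
Set Implicit Arguments.
Unset Strict Implicit.
Unset Printing Implicit Defensive.
Local Open Scope classical_set_scope.
Local Open Scope ring_scope.

(** Write L for the square root of 2 ln n. An entry of standard deviation s exceeds
    L b with probability about n^(- b^2 / s^2). Hence a pattern L B, at fixed
    vertices for the positions in U, has probability about n^(- energy of B on U),
    while U can be placed in about n^#|U| ways. The constraints defining the
    feasible set say exactly that, for no U, is the expected number of placements
    of the pattern on U negligible.

    Upper bound. If the sparse maximum exceeds gamma (1 + t) L, then the principal
    submatrix supporting a near-maximizer, divided by (1 + t) L, is not feasible
    (sparse_max_gt_energy), so some U has energy above (1 + t)^2 #|U| L^2. A weighted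
    sum of independent Gaussian squares exceeds such a level with probability
    O(n^(- (1 + t) #|U|)) (sum_squares_tail), which beats the n^#|U| placements of U
    (sparse_max_upper).

    Lower bound. A near-optimal feasible B and its test vector x can be replaced by
    their absolute values (gamma_max_approx). So only one-sided bounds on the
    entries are needed: it suffices to find vertices whose entries exceed
    (1 - delta) L B. The second moment method, applied to tuples with one vertex
    in each of k disjoint blocks (pr_no_tuple_event), bounds the probability of
    failure by a sum over nonempty U of n^(- #|U|) divided by the probability of the
    pattern on U; by feasibility and the shrinking factor this is
    O(n^(- delta)) (sparse_max_lower).

    Two facts connect these estimates to the definitions. Eigenvalues of symmetric
    matrices are compared with quadratic forms through rayleigh_eigenvalue. The
    deviation events are measurable because the sparse maximum is a supremum over
    countably many test directions (measurable_sparse_max). *)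

(** * Quadratic forms and the largest eigenvalue *)

Section QuadraticForms.
Variable R : realType.

Lemma quad_formE n (B : 'M[R]_n) (x : 'cV[R]_n) :
  quad_form B x = \sum_i \sum_j x i 0 * B i j * x j 0.
Proof.
rewrite /quad_form mxE exchange_big /=; apply: eq_bigr => j _.
by rewrite mxE mulr_suml; apply: eq_bigr => i _; rewrite !mxE.
Qed.

Definition sqnorm n (x : 'cV[R]_n) : R := \sum_i x i 0 ^+ 2.

Lemma sqnorm_ge0 n (x : 'cV[R]_n) : 0 <= sqnorm x.
Proof. by apply: sumr_ge0 => i _; exact: sqr_ge0. Qed.

Lemma sqnorm_eq0 n (x : 'cV[R]_n) : (sqnorm x == 0) = (x == 0).
Proof.
apply/idP/eqP => [|->]; last by rewrite /sqnorm big1// => i _; rewrite mxE expr0n.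
rewrite psumr_eq0 => [/allP x0|i _]; last exact: sqr_ge0.
apply/colP => i; rewrite mxE; apply/eqP.
by rewrite -sqrf_eq0; exact: (x0 i (mem_index_enum _)).
Qed.

Lemma sqnorm_gt0 n (x : 'cV[R]_n) : (0 < sqnorm x) = (x != 0).
Proof. by rewrite lt_neqAle eq_sym sqnorm_eq0 sqnorm_ge0 andbT. Qed.

Lemma sqnorm0 n : sqnorm (0 : 'cV[R]_n) = 0.
Proof. by apply/eqP; rewrite sqnorm_eq0. Qed.

Lemma sqnorm_delta n (i : 'I_n) : sqnorm (delta_mx i 0) = 1.
Proof.
rewrite /sqnorm (bigD1 i)//= big1 ?addr0 => [|j ji]; rewrite mxE ?eqxx ?expr1n//.
by rewrite (negbTE ji) expr0n.
Qed.

Lemma l2norm1 n (x : 'cV[R]_n) : l2norm x = 1 <-> sqnorm x = 1.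
Proof.
rewrite /l2norm -/(sqnorm x); split => [x1|->]; last by rewrite sqrtr1.
by rewrite -(sqr_sqrtr (sqnorm_ge0 x)) x1 expr1n.
Qed.

Lemma quad_formZ n (B : 'M[R]_n) (a : R) (x : 'cV[R]_n) :
  quad_form B (a *: x) = a ^+ 2 * quad_form B x.
Proof.
rewrite !quad_formE mulr_sumr; apply: eq_bigr => i _.
rewrite mulr_sumr; apply: eq_bigr => j _; rewrite !mxE; ring.
Qed.

Lemma sqnormZ n (a : R) (x : 'cV[R]_n) : sqnorm (a *: x) = a ^+ 2 * sqnorm x.
Proof. by rewrite /sqnorm mulr_sumr; apply: eq_bigr => i _; rewrite mxE exprMn. Qed.

Definition normalize n (x : 'cV[R]_n) : 'cV[R]_n := (Num.sqrt (sqnorm x))^-1 *: x.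

Lemma sqnorm_normalize n (x : 'cV[R]_n) : x != 0 -> sqnorm (normalize x) = 1.
Proof.
rewrite -sqnorm_gt0 => x0.
by rewrite sqnormZ exprVn sqr_sqrtr ?ltW// mulVf ?gt_eqF.
Qed.

Lemma quad_form_normalize n (B : 'M[R]_n) (x : 'cV[R]_n) :
  quad_form B (normalize x) = quad_form B x / sqnorm x.
Proof. by rewrite quad_formZ exprVn sqr_sqrtr ?sqnorm_ge0// mulrC. Qed.

Lemma quad_formZl n (B : 'M[R]_n) (a : R) (x : 'cV[R]_n) :
  quad_form (a *: B) x = a * quad_form B x.
Proof.
rewrite !quad_formE mulr_sumr; apply: eq_bigr => i _.
rewrite mulr_sumr; apply: eq_bigr => j _; rewrite !mxE; ring.
Qed.

Lemma quad_form_scalar n (a : R) (x : 'cV[R]_n) :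
  quad_form a%:M x = a * sqnorm x.
Proof.
rewrite quad_formE mulr_sumr; apply: eq_bigr => i _.
rewrite (bigD1 i)//= big1 ?addr0 => [|j ji]; rewrite !mxE ?eqxx ?mulr1n; first ring.
by rewrite eq_sym (negbTE ji) mulr0n mulr0 mul0r.
Qed.

Lemma quad_formD n (B C : 'M[R]_n) (x : 'cV[R]_n) :
  quad_form (B + C) x = quad_form B x + quad_form C x.
Proof. by rewrite /quad_form mulmxDr mulmxDl mxE. Qed.

Lemma quad_formN n (B : 'M[R]_n) (x : 'cV[R]_n) :
  quad_form (- B) x = - quad_form B x.
Proof. by rewrite /quad_form mulmxN mulNmx mxE. Qed.

Lemma ler_norm_quad_form n (B : 'M[R]_n) (x : 'cV[R]_n) :
  `|quad_form B x| <= (\sum_i \sum_j `|B i j|) * sqnorm x.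
Proof.
rewrite quad_formE mulr_suml (le_trans (ler_norm_sum _ _ _))//.
apply: ler_sum => i _; rewrite mulr_suml (le_trans (ler_norm_sum _ _ _))//.
apply: ler_sum => j _; rewrite !normrM.
rewrite (mulrC `|x i 0|) -mulrA ler_wpM2l//.
have xle l : `|x l 0| ^+ 2 <= sqnorm x.
  rewrite real_normK ?num_real// /sqnorm (bigD1 l)//= lerDl.
  by apply: sumr_ge0 => ? _; exact: sqr_ge0.
have := xle i; have := xle j; have := sqr_ge0 (`|x i 0| - `|x j 0|); nra.
Qed.

Lemma quad_form_polar n (M : 'M[R]_n) (x y : 'cV[R]_n) (t : R) : M^T = M ->
  quad_form M (x + t *: y) =
  quad_form M x + 2 * t * (x^T *m M *m y) 0 0 + t ^+ 2 * quad_form M y.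
Proof.
move=> Msym; have yMx : (y^T *m M *m x) 0 0 = (x^T *m M *m y) 0 0.
  have -> : y^T *m M *m x = (x^T *m M *m y)^T.
    by rewrite !trmx_mul trmxK Msym mulmxA.
  by rewrite [LHS]mxE.
have xyT : (x + t *: y)^T = x^T + t *: y^T by apply/rowP => i; rewrite !mxE.
rewrite /quad_form xyT !mulmxDl !mulmxDr -!scalemxAl -!scalemxAr.
have addE (U V : 'M[R]_1) : (U + V) 0 0 = U 0 0 + V 0 0 by rewrite mxE.
have scaleE a (U : 'M[R]_1) : (a *: U) 0 0 = a * U 0 0 by rewrite mxE.
rewrite !addE !scaleE yMx; ring.
Qed.

(** The polynomial t -> quad_form M (x + t y) is nonnegative, so its discriminant
    is nonpositive. *)
Lemma psd_cauchy_schwarz n (M : 'M[R]_n) (x y : 'cV[R]_n) : M^T = M ->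
  (forall z, 0 <= quad_form M z) ->
  (x^T *m M *m y) 0 0 ^+ 2 <= quad_form M x * quad_form M y.
Proof.
move=> Msym psd; set b := _ 0 0; set p := quad_form M x; set q := quad_form M y.
have H t : 0 <= p + 2 * t * b + t ^+ 2 * q.
  by rewrite -quad_form_polar.
have p0 : 0 <= p := psd x. have q0 : 0 <= q := psd y.
have [q00|qN0] := eqVneq q 0.
  rewrite q00 mulr0 in H *.
  (* Here the expression is p + 2 t b; for b nonzero this t makes it - p - 2 < 0. *)
  have := H (- (p + 1) * b / (b ^+ 2)).
  have [->|bN0] := eqVneq b 0; first by rewrite expr0n.
  have -> : 2 * (- (p + 1) * b / b ^+ 2) * b = - 2 * (p + 1) by field.
  lra.
have := H (- b / q).
have -> : p + 2 * (- b / q) * b + (- b / q) ^+ 2 * q = (p * q - b ^+ 2) / q.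
  by field.
have qp : 0 < q by rewrite lt_neqAle eq_sym qN0.
by rewrite pmulr_lge0 ?invr_gt0// subr_ge0.
Qed.

Lemma dot_self n (x : 'cV[R]_n) : (x^T *m x) 0 0 = sqnorm x.
Proof. by rewrite mxE; apply: eq_bigr => i _; rewrite mxE expr2. Qed.

(** Apply Cauchy-Schwarz for the form M to x and M^-1 x: the pairing is |x|^2, and
    the form at M^-1 x is at most a constant times |x|^2. It stands in
    for compactness of the unit sphere in rayleigh_eigenvalue. *)
Lemma psd_unit_coercive n (M : 'M[R]_n) : M^T = M ->
  (forall z, 0 <= quad_form M z) -> M \in unitmx ->
  exists2 c, 0 < c & forall x, c * sqnorm x <= quad_form M x.
Proof.
move=> Msym psd Mu; pose C := 1 + \sum_i \sum_j `|invmx M i j|.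
have S0 : 0 <= \sum_i \sum_j `|invmx M i j|.
  by apply: sumr_ge0 => i _; apply: sumr_ge0.
have C0 : 0 < C by rewrite /C; lra.
exists C^-1; first by rewrite invr_gt0.
move=> x; have [->|xN0] := eqVneq x 0.
  by rewrite sqnorm0 mulr0.
have xp : 0 < sqnorm x by rewrite sqnorm_gt0.
have := psd_cauchy_schwarz x (invmx M *m x) Msym psd.
rewrite mulmxA -(mulmxA x^T) mulmxV// mulmx1 dot_self.
have -> : quad_form M (invmx M *m x) = quad_form (invmx M) x.
  by rewrite /quad_form trmx_mul trmx_inv Msym -!mulmxA mulKVmx.
move=> H; have Hi : quad_form (invmx M) x <= C * sqnorm x.
  apply: (le_trans (ler_norm _)); apply: (le_trans (ler_norm_quad_form _ _)).
  by rewrite ler_wpM2r ?sqnorm_ge0// /C; lra.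
rewrite ler_pdivrMl//.
have : sqnorm x ^+ 2 <= quad_form M x * (C * sqnorm x).
  by apply: (le_trans H); rewrite ler_wpM2l.
by rewrite expr2 mulrA ler_pM2r// mulrC.
Qed.

Lemma eigenvalue_quad_form n (B : 'M[R]_n) (l : R) : B^T = B ->
  eigenvalue B l -> exists2 x, sqnorm x = 1 & quad_form B x = l.
Proof.
move=> Bsym /eigenvalueP[v vB vN0].
have vTN0 : v^T != 0 by rewrite trmx_eq0.
exists (normalize v^T); first exact: sqnorm_normalize.
rewrite quad_form_normalize /quad_form trmxK vB -scalemxAl mxE.
by rewrite -{1}(trmxK v) dot_self mulfK// sqnorm_eq0.
Qed.

Definition rayleigh_sup n (B : 'M[R]_n) : R :=
  sup [set quad_form B x | x in [set x | sqnorm x = 1]].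

Lemma rayleigh_ub n (B : 'M[R]_n) :
  has_ubound [set quad_form B x | x in [set x | sqnorm x = 1]].
Proof.
exists (\sum_i \sum_j `|B i j|) => _ [x /= x1 <-].
by rewrite (le_trans (ler_norm _))// (le_trans (ler_norm_quad_form _ _))// x1 mulr1.
Qed.

Lemma unit_vector_exists n : (0 < n)%N -> exists x : 'cV[R]_n, sqnorm x = 1.
Proof.
by case: n => // n _; exists (delta_mx 0 0); exact: sqnorm_delta.
Qed.

Lemma quad_form_le_rayleigh n (B : 'M[R]_n) x :
  quad_form B x <= rayleigh_sup B * sqnorm x.
Proof.
have [->|xN0] := eqVneq x 0.
  by rewrite sqnorm0 mulr0 /quad_form mulmx0 mxE.
rewrite -ler_pdivrMr ?sqnorm_gt0//; apply: ub_le_sup; first exact: rayleigh_ub.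
by exists (normalize x); [exact: sqnorm_normalize|rewrite quad_form_normalize].
Qed.

(** Otherwise l I - B, which is positive semidefinite for l the supremum, would be
    invertible, hence bounded below by some c > 0, and l - c would bound the
    Rayleigh quotients. *)
Lemma rayleigh_eigenvalue n (B : 'M[R]_n) : (0 < n)%N -> B^T = B ->
  eigenvalue B (rayleigh_sup B).
Proof.
move=> n0 Bsym; set l := rayleigh_sup B.
have [u u1] := unit_vector_exists n0.
rewrite /eigenvalue /eigenspace kermx_eq0 row_free_unit; apply/negP => Mu.
pose M := l%:M - B.
have MN : M = - (B - l%:M) by rewrite /M opprB.
have Msym : M^T = M by rewrite /M linearB /= tr_scalar_mx Bsym.
have qM x : quad_form M x = l * sqnorm x - quad_form B x.
  by rewrite /M quad_formD quad_formN quad_form_scalar.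
have psd x : 0 <= quad_form M x by rewrite qM subr_ge0 quad_form_le_rayleigh.
have MU : M \in unitmx.
  by rewrite MN -scaleN1r unitmxZ ?unitrN1.
have [c c0 cM] := psd_unit_coercive Msym psd MU.
suff : l <= l - c by lra.
apply: sup_le_ub; first by exists (quad_form B u), u.
by move=> _ [x /= x1 <-]; have := cM x; rewrite qM x1; lra.
Qed.

Lemma lambda_max_rayleigh n (B : 'M[R]_n) : (0 < n)%N -> B^T = B ->
  lambda_max B = rayleigh_sup B.
Proof.
move=> n0 Bsym; rewrite /lambda_max.
have ub : ubound [set l | eigenvalue B l] (rayleigh_sup B).
  move=> l /= /(eigenvalue_quad_form Bsym)[x x1 <-].
  by have := quad_form_le_rayleigh B x; rewrite x1 mulr1.
apply/eqP; rewrite eq_le; apply/andP; split.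
  by apply: sup_le_ub => //; exists (rayleigh_sup B); exact: rayleigh_eigenvalue.
by apply: ub_le_sup; [exists (rayleigh_sup B)|exact: rayleigh_eigenvalue].
Qed.

Lemma quad_form_le_lambda_max n (B : 'M[R]_n) x : B^T = B ->
  sqnorm x = 1 -> quad_form B x <= lambda_max B.
Proof.
move=> Bsym x1; case: n => [|n] in B x Bsym x1 *.
  by move: x1; rewrite /sqnorm big_ord0 => /eqP; rewrite eq_sym oner_eq0.
by rewrite lambda_max_rayleigh//; have := quad_form_le_rayleigh B x; rewrite x1 mulr1.
Qed.

End QuadraticForms.

(** * The variational constant *)

Section Gamma.
Variable R : realType.

Definition upairs m (U : {set 'I_m}) : {set 'I_m * 'I_m} :=
  [set p | [&& p.1 \in U, p.2 \in U & (p.1 <= p.2)%N]].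

(** The normalization of a diagonal (a) or off-diagonal (1) entry. With a = alpha^2
    it is the variance of the random entry, with a = alpha its standard
    deviation. *)
Definition entry_scale m (a : R) (p : 'I_m * 'I_m) : R :=
  if p.1 == p.2 then a else 1.

(** Diagonal and off-diagonal terms merged into a single sum over independent
    entries, which is the form in which probabilities factor. *)
Lemma energyE m (a : R) (U : {set 'I_m}) (B : 'M[R]_m) :
  energy a U B = \sum_(p in upairs U) B p.1 p.2 ^+ 2 / entry_scale a p.
Proof.
have -> : \sum_(p in upairs U) B p.1 p.2 ^+ 2 / entry_scale a p =
    \sum_(i in U) \sum_(j | (j \in U) && (i <= j)%N)
      B i j ^+ 2 / entry_scale a (i, j).
  rewrite pair_big_dep /=; apply: eq_big => [[i j]|[i j]//].
  by rewrite inE.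
rewrite /energy mulr_sumr -big_split /=; apply: eq_bigr => i iU.
rewrite [RHS](bigD1 i)/= ?iU ?leqnn//.
rewrite {1}/entry_scale/= eqxx [in LHS]mulrC; congr (_ + _).
apply: eq_big => [j|j /andP[_ ij]].
  by rewrite -andbA; congr (_ && _); rewrite ltn_neqAle andbC eq_sym.
by rewrite /entry_scale/= ifF ?divr1//; apply/negbTE; rewrite neq_ltn ij.
Qed.

Lemma entry_scale_gt0 m (a : R) (p : 'I_m * 'I_m) : 0 < a -> 0 < entry_scale a p.
Proof. by rewrite /entry_scale; case: eqP. Qed.

Lemma energyZ m (a : R) (U : {set 'I_m}) (c : R) (B : 'M[R]_m) :
  energy a U (c *: B) = c ^+ 2 * energy a U B.
Proof.
rewrite !energyE mulr_sumr; apply: eq_bigr => p _.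
by rewrite mxE exprMn mulrA.
Qed.

Lemma feasible_entry m (a : R) (B : 'M[R]_m) i j : 0 < a ->
  feasible a B -> `|B i j| <= 1 + (1 + a) * m%:R.
Proof.
move=> a0 [Bsym BE]; wlog ij : i j / (i <= j)%N.
  move=> H; have [ij|/ltnW ji] := leqP i j; first exact: H.
  by rewrite -Bsym mxE; exact: H.
have m0 : (0 < m)%N by case: m i {BE Bsym B j ij} => // -[].
have := BE [set: 'I_m]%SET; rewrite cardsT card_ord energyE => /(_ m0) Em.
have Bij : B i j ^+ 2 / entry_scale a (i, j) <= m%:R.
  apply: le_trans Em; rewrite (bigD1 (i, j))/= ?inE ?ij// lerDl.
  apply: sumr_ge0 => p _; apply: divr_ge0; first exact: sqr_ge0.
  exact/ltW/entry_scale_gt0.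
have v0 : 0 < entry_scale a (i, j) by exact: entry_scale_gt0.
have v1 : entry_scale a (i, j) <= 1 + a by rewrite /entry_scale; case: eqP => _; lra.
have B2 : B i j ^+ 2 <= (1 + a) * m%:R.
  rewrite ler_pdivrMr// mulrC in Bij; apply: (le_trans Bij).
  by rewrite ler_wpM2r.
have := sqr_ge0 (1 - `|B i j|).
have : `|B i j| ^+ 2 = B i j ^+ 2 by rewrite real_normK ?num_real.
have := normr_ge0 (B i j); nra.
Qed.

Lemma feasible0 m (a : R) : feasible a (0 : 'M[R]_m).
Proof.
split=> [|U _]; first by rewrite trmx0.
by rewrite energyE big1// => p _; rewrite mxE expr0n mul0r.
Qed.

Lemma gamma_has_sup m (a : R) : (0 < m)%N -> 0 < a ->
  has_sup [set lambda_max B | B in feasible (m := m) a].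
Proof.
move=> m0 a0; split; first by exists (lambda_max (0 : 'M[R]_m)), 0 => //; exact: feasible0.
exists (\sum_(i < m) \sum_(j < m) (1 + (1 + a) * m%:R)) => _ [B /= fB <-].
rewrite lambda_max_rayleigh//; last by case: fB.
have [x x1] := unit_vector_exists R m0.
apply: sup_le_ub; first by exists (quad_form B x), x.
move=> _ [y /= y1 <-]; rewrite (le_trans (ler_norm _))//.
rewrite (le_trans (ler_norm_quad_form _ _))// y1 mulr1.
by apply: ler_sum => i _; apply: ler_sum => j _; exact: feasible_entry.
Qed.

Lemma quad_form_le_gamma m (a : R) (B : 'M[R]_m) x : 0 < a ->
  feasible a B -> sqnorm x = 1 -> quad_form B x <= gamma_max m a.
Proof.
move=> a0 fB x1; case: m => [|m] in B x fB x1 *.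
  by move: x1; rewrite /sqnorm big_ord0 => /eqP; rewrite eq_sym oner_eq0.
have [Bsym _] := fB.
apply: (le_trans (quad_form_le_lambda_max Bsym x1)).
by apply: ub_le_sup; [case: (gamma_has_sup (ltn0Sn m) a0)|exists B].
Qed.

Lemma gamma_max_ge0 m (a : R) : (0 < m)%N -> 0 < a -> 0 <= gamma_max m a.
Proof.
move=> m0 a0; have [x x1] := unit_vector_exists R m0.
apply: le_trans (quad_form_le_gamma a0 (feasible0 m a) x1).
by rewrite /quad_form mulmx0 mul0mx mxE.
Qed.

(** Replacing B and x by their entrywise absolute values preserves the
    constraints, which only see squares, and does not decrease the form. *)
Lemma gamma_max_approx m (a e : R) : (0 < m)%N -> 0 < a -> 0 < e ->
  exists (B : 'M[R]_m) (x : 'cV[R]_m),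
    [/\ feasible a B, forall i j, 0 <= B i j, forall i, 0 <= x i 0,
        sqnorm x = 1 & gamma_max m a - e < quad_form B x].
Proof.
move=> m0 a0 e0.
have [_ [B fB <-] BG] := sup_adherent e0 (gamma_has_sup m0 a0).
have [Bsym BE] := fB.
have [y y1 yB] := eigenvalue_quad_form Bsym (rayleigh_eigenvalue m0 Bsym).
rewrite lambda_max_rayleigh// -yB in BG.
exists (map_mx Num.norm B), (map_mx Num.norm y); split.
- split=> [|U U0]; first by apply/matrixP => i j; rewrite !mxE -{1}Bsym mxE.
  rewrite energyE (le_trans _ (BE U U0))// energyE le_eqVlt; apply/orP; left.
  by apply/eqP/eq_bigr => p _; rewrite mxE real_normK ?num_real.
- by move=> i j; rewrite mxE.
- by move=> i; rewrite mxE.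
- by rewrite -y1; apply: eq_bigr => i _; rewrite mxE real_normK ?num_real.
- apply: (lt_le_trans BG); rewrite !quad_formE.
  apply: ler_sum => i _; apply: ler_sum => j _.
  by rewrite !mxE -!normrM ler_norm.
Qed.

End Gamma.

(** * Sparse maximum and principal submatrices *)

Section SparseMax.
Variable R : realType.

Definition principal_submx n k (A : 'M[R]_n) (f : 'I_k -> 'I_n) : 'M[R]_k :=
  \matrix_(i, j) A (f i) (f j).

Lemma sum_inj_support n k (f : 'I_k -> 'I_n) (F : 'I_n -> R) : injective f ->
  (forall j, j \notin codom f -> F j = 0) -> \sum_j F j = \sum_i F (f i).
Proof.
move=> finj F0; rewrite (bigID (mem (codom f)))/= [X in _ + X]big1//.
rewrite addr0 -(big_imset (A := predT) F)/=; last by move=> x y _ _; exact: finj.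
apply: eq_bigl => j; apply/codomP/imsetP => [[i ->]|[i _ ->]]; by exists i.
Qed.

Lemma quad_form_sub n k (A : 'M[R]_n) (f : 'I_k -> 'I_n) (x : 'cV[R]_n) :
  injective f -> (forall j, j \notin codom f -> x j 0 = 0) ->
  quad_form A x = quad_form (principal_submx A f) (\col_i x (f i) 0).
Proof.
move=> finj x0; rewrite !quad_formE (sum_inj_support finj); last first.
  by move=> j /x0 ->; rewrite big1// => i _; rewrite !mul0r.
apply: eq_bigr => i _; rewrite (sum_inj_support finj); last first.
  by move=> j /x0 ->; rewrite mulr0.
by apply: eq_bigr => j _; rewrite !mxE.
Qed.

Lemma sqnorm_sub n k (f : 'I_k -> 'I_n) (x : 'cV[R]_n) :
  injective f -> (forall j, j \notin codom f -> x j 0 = 0) ->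
  sqnorm x = sqnorm (\col_i x (f i) 0).
Proof.
move=> finj x0; rewrite /sqnorm (sum_inj_support finj).
  by apply: eq_bigr => i _; rewrite mxE.
by move=> j /x0 ->; rewrite expr0n.
Qed.

Definition sparse_unit n k : set 'cV[R]_n :=
  [set x | (l0norm x <= k)%N /\ sqnorm x = 1].

Lemma sparse_maxE n k (A : 'M[R]_n) :
  sparse_max k A = sup [set quad_form A x | x in sparse_unit k].
Proof.
rewrite /sparse_max; congr (sup (_ @` _)).
by apply/seteqP; split => x [xk /l2norm1 x1].
Qed.

Lemma sparse_max_has_ubound n k (A : 'M[R]_n) :
  has_ubound [set quad_form A x | x in sparse_unit k].
Proof.
have [c cub] := rayleigh_ub A; exists c => _ [x [_ x1] <-].
by apply: cub; exists x.
Qed.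

Lemma quad_form_le_sparse_max n k (A : 'M[R]_n) x : sparse_unit k x ->
  quad_form A x <= sparse_max k A.
Proof.
move=> xk; rewrite sparse_maxE; apply: ub_le_sup; first exact: sparse_max_has_ubound.
by exists x.
Qed.

Lemma sparse_max_gtP n k (A : 'M[R]_n) c : (0 < k)%N -> (0 < n)%N ->
  c < sparse_max k A -> exists2 x, sparse_unit k x & c < quad_form A x.
Proof.
move=> k0 n0; rewrite sparse_maxE => /sup_gt[|_ [x xk <-] cx]; last by exists x.
case: n n0 A => // n _ A; exists (quad_form A (delta_mx 0 0)), (delta_mx 0 0) => //.
split; last exact: sqnorm_delta.
apply: leq_trans k0; rewrite /l0norm -[leqRHS](card1 (0 : 'I_n.+1)); apply/subset_leq_card.
apply/fintype.subsetP => i; rewrite !inE mxE; case: (i == 0) => //=.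
by rewrite eqxx.
Qed.

Lemma sparse_max_ge_principal n k (A : 'M[R]_n) (f : 'I_k -> 'I_n) x :
  injective f -> sqnorm x = 1 ->
  quad_form (principal_submx A f) x <= sparse_max k A.
Proof.
move=> finj x1; pose y : 'cV[R]_n := \col_j \sum_(i | f i == j) x i 0.
have yf i : y (f i) 0 = x i 0.
  rewrite mxE (eq_bigl (pred1 i)) ?big_pred1_eq// => j /=.
  by rewrite (inj_eq finj).
have y0 j : j \notin codom f -> y j 0 = 0.
  move=> jf; rewrite mxE big1// => i /eqP fij.
  by rewrite -fij codom_f in jf.
have xE : x = \col_i y (f i) 0 by apply/colP => i; rewrite mxE yf.
rewrite xE -quad_form_sub//; apply: quad_form_le_sparse_max; split; last first.
  by rewrite (sqnorm_sub finj)// -xE.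
rewrite /l0norm -[leqRHS](card_ord k) -(card_codom finj).
apply/subset_leq_card/fintype.subsetP => j; rewrite inE; apply: contraR.
by move=> /y0 ->.
Qed.

(** Take the first k elements of an enumeration that lists S first. *)
Lemma extend_to_card (T : finType) (S : {set T}) k :
  (#|S| <= k)%N -> (k <= #|T|)%N ->
  exists S' : {set T}, S \subset S' /\ #|S'| = k.
Proof.
move=> Sk kT; pose s := enum S ++ enum (~: S).
have us : uniq s.
  rewrite cat_uniq !enum_uniq /= andbT; apply/hasPn => x.
  by rewrite !mem_enum inE.
have ss : size s = #|T| by rewrite size_cat -!cardE cardsC.
exists [set x in take k s]; split.
  apply/fintype.subsetP => x xS; rewrite inE take_cat -cardE ltnNge Sk /=.
  by rewrite mem_cat mem_enum xS.
rewrite cardsE (card_uniqP _) ?take_uniq// size_takel// ss//.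
Qed.

Lemma increasing_enum n (S : {set 'I_n}) k : #|S| = k ->
  exists f : 'I_k -> 'I_n, {mono f : i j / (i < j)%N} /\
    (forall j, j \in S -> j \in codom f).
Proof.
move=> <-; exists (@Order.enum_val _ _ S); split.
  by move=> i j; exact: (leW_mono (Order.EnumVal.le_enum_val (@le_total _ 'I_n) (A := S)) i j).
move=> j jS; apply/codomP; exists (Order.enum_rank_in jS j).
by rewrite Order.EnumVal.enum_rankK_in.
Qed.

(** Were the submatrix supporting a near-maximizer, divided by c, feasible, its
    quadratic form could not exceed gamma; so some set of positions violates its
    energy constraint. The support is padded to exactly k indices and enumerated
    increasingly, so that ordered positions give entries on or above the
    diagonal. *)
Lemma sparse_max_gt_energy n k (a c : R) (A : 'M[R]_n) :
  (0 < k)%N -> (k <= n)%N -> 0 < a -> 0 < c -> A^T = A ->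
  gamma_max k a * c < sparse_max k A ->
  exists (f : 'I_k -> 'I_n) (U : {set 'I_k}),
    [/\ {mono f : i j / (i < j)%N}, (0 < #|U|)%N &
        #|U|%:R * c ^+ 2 < energy a U (principal_submx A f)].
Proof.
move=> k0 kn a0 c0 Asym /(sparse_max_gtP k0 (leq_trans k0 kn))[x [xk x1] Ax].
have [||S [supp_S cS]] := @extend_to_card _ [set i | x i 0 != 0] k.
- by rewrite cardsE.
- by rewrite card_ord.
have [f [fmono fS]] := increasing_enum cS.
have finj : injective f.
  move=> i j fij; apply/eqP; rewrite -[_ == _]negbK neq_ltn -!fmono fij.
  by rewrite ltnn.
have x0 j : j \notin codom f -> x j 0 = 0.
  move=> jf; apply/eqP; apply: contraR jf => xj; apply: fS.
  by apply: (fintype.subsetP supp_S); rewrite inE.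
pose B := c^-1 *: principal_submx A f.
have : ~ feasible a B.
  move=> fB; move: x1; rewrite (sqnorm_sub finj)// => x1.
  have := quad_form_le_gamma a0 fB x1.
  rewrite quad_formZl -quad_form_sub// mulrC ler_pdivrMr// leNgt.
  by rewrite Ax.
move=> /not_andP[|/existsNP[U /not_implyP[U0 /negP]]].
  by case; apply/matrixP => i j; rewrite !mxE -{1}Asym mxE.
rewrite -ltNge energyZ exprVn mulrC ltr_pdivlMr ?exprn_gt0// => EU.
by exists f, U.
Qed.

End SparseMax.

(** * Measurability of the sparse maximum *)

Section Measurability.
Variable R : realType.

Lemma cvg_sumr (I : finType) (u : I -> R^nat) (l : I -> R) :
  (forall i, u i @ \oo --> l i) ->
  (fun N => \sum_i u i N) @ \oo --> \sum_i l i.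
Proof.
move=> ul; elim: (index_enum I) => [|i r IH].
  by rewrite big_nil; under eq_fun do rewrite big_nil; exact: cvg_cst.
by rewrite big_cons; under eq_fun do rewrite big_cons; exact: cvgD.
Qed.

Definition int_scaling n (x : 'cV[R]_n) (N : nat) : 'cV[int]_n :=
  \col_i Num.floor (x i 0 * N.+1%:R).

Lemma cvg_int_scaling n (x : 'cV[R]_n) i :
  (fun N => (int_scaling x N i 0)%:~R / N.+1%:R) @ \oo --> x i 0.
Proof.
apply: (@squeeze_cvgr _ _ _ _ (fun N => x i 0 - harmonic N)
  (fun=> x i 0)).
- near=> N; rewrite mxE /harmonic /=.
  have N0 : 0 < N.+1%:R :> R by rewrite ltr0n.
  rewrite ler_pdivlMr// mulrBl mulVf ?gt_eqF// ler_pdivrMr//.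
  have /andP[h1 h2] := floor_itv (x i 0 * N.+1%:R).
  by rewrite h1 andbT; move: h2; rewrite intrD; lra.
- rewrite -[X in _ --> X]subr0; apply: cvgB; first exact: cvg_cst.
  exact: cvg_harmonic.
- exact: cvg_cst.
Unshelve. all: by end_near. Qed.

(** Both sides of c |x|^2 < x^T B x are homogeneous of degree two, so a strict
    inequality can be witnessed by an integer vector. *)
Lemma int_vector_witness n k (B : 'M[R]_n) (x : 'cV[R]_n) c :
  (l0norm x <= k)%N -> c * sqnorm x < quad_form B x ->
  exists z : 'cV[int]_n, (l0norm (map_mx intr z : 'cV[R]_n) <= k)%N /\
    c * sqnorm (map_mx intr z : 'cV[R]_n) < quad_form B (map_mx intr z).
Proof.
move=> xk cx; pose y N : 'cV[R]_n := map_mx intr (int_scaling x N).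
have yx i := @cvg_int_scaling _ x i.
pose v N := N.+1%:R^-1 *: y N.
have vE N i : v N i 0 = (int_scaling x N i 0)%:~R / N.+1%:R.
  by rewrite !mxE mulrC.
have lim : (fun N => quad_form B (v N) - c * sqnorm (v N)) @ \oo -->
    quad_form B x - c * sqnorm x.
  apply: cvgB; last first.
    apply: cvgM; first exact: cvg_cst.
    apply: cvg_sumr => i; rewrite expr2.
    by under eq_fun do rewrite vE expr2; exact: cvgM.
  rewrite quad_formE; under eq_fun do rewrite quad_formE.
  apply: cvg_sumr => i; apply: cvg_sumr => j; under eq_fun do rewrite !vE.
  by apply: cvgM => //; apply: cvgM => //; exact: cvg_cst.
have /(cvgr_gt _ lim)[N _ /(_ N (leqnn N)) /=] : 0 < quad_form B x - c * sqnorm x.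
  by rewrite subr_gt0.
rewrite /v quad_formZ sqnormZ mulrCA -mulrBr pmulr_rgt0 ?exprn_gt0 ?invr_gt0//.
rewrite subr_gt0 => cy; exists (int_scaling x N); split => //.
apply: leq_trans xk; apply/subset_leq_card/fintype.subsetP => i.
rewrite !inE !mxE; apply: contraNN => /eqP ->.
by rewrite mul0r floor0.
Qed.

Lemma measurable_quad_form d (T : measurableType d) n (A : T -> 'M[R]_n) x :
  (forall i j, measurable_fun setT (fun w => A w i j)) ->
  measurable_fun setT (fun w => quad_form (A w) x).
Proof.
move=> mA; under eq_fun do rewrite quad_formE.
apply: measurable_sum => i; apply: measurable_sum => j.
by apply: measurable_funM => //; exact: measurable_funM.
Qed.

(** The superlevel sets are countable unions over integer test vectors, which
    after normalization compete in the supremum. *)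
Lemma measurable_sparse_max d (T : measurableType d) n k (A : T -> 'M[R]_n) :
  (0 < k)%N -> (0 < n)%N ->
  (forall i j, measurable_fun setT (fun w => A w i j)) ->
  measurable_fun setT (fun w => sparse_max k (A w)).
Proof.
move=> k0 n0 mA mD; apply: (measurability _ (RGenOInfty.measurableE R)) => //.
move=> /= _ [_ [c ->] <-]; rewrite preimage_itvoy setTI.
have -> : [set w | c < sparse_max k (A w)] =
    \bigcup_(z : 'cV[int]_n) [set w | (l0norm (map_mx intr z : 'cV[R]_n) <= k)%N /\
     c * sqnorm (map_mx intr z : 'cV[R]_n) < quad_form (A w) (map_mx intr z)].
  apply/seteqP; split => [w /= /(sparse_max_gtP k0 n0)[x [xk x1] cx]|].
    have [|z [zk cz]] := @int_vector_witness n k (A w) x c xk.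
      by rewrite x1 mulr1.
    by exists z.
  move=> w [z _ /= [zk cz]]; set x := map_mx intr z in zk cz.
  have xN0 : x != 0.
    apply: contraTN cz => /eqP ->.
    by rewrite sqnorm0 mulr0 /quad_form mulmx0 mxE ltxx.
  apply: (@lt_le_trans _ _ (quad_form (A w) (normalize x))).
    by rewrite quad_form_normalize ltr_pdivlMr// sqnorm_gt0.
  apply: quad_form_le_sparse_max; split; last exact: sqnorm_normalize.
  apply: leq_trans zk; apply/subset_leq_card/fintype.subsetP => i.
  by rewrite !inE mxE; apply: contraNN => /eqP ->; rewrite mulr0.
apply: countable_bigcupT_measurable => [|z]; first exact: countableP.
case: (boolP (l0norm (map_mx intr z : 'cV[R]_n) <= k)%N) => zk; last first.
  rewrite (_ : [set _ | _] = set0); first exact: measurable0.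
  by apply/seteqP; split => // w [].
rewrite (_ : [set _ | _] =
   [set w | c * sqnorm (map_mx intr z : 'cV[R]_n) < quad_form (A w) (map_mx intr z)]).
  rewrite -[X in measurable X]setTI -preimage_itvoy.
  by apply: measurable_quad_form => //; exact: measurable_itv.
by apply/seteqP; split => w //= [].
Qed.

Lemma measurable_sparse_max_random d (T : measurableType d) (P : probability T R)
    n k (A : 'I_n -> 'I_n -> {RV P >-> R}) : (0 < k)%N -> (0 < n)%N ->
  measurable_fun setT (fun w => sparse_max k (random_matrix A w)).
Proof.
move=> k0 n0; apply: measurable_sparse_max => // i j.
rewrite (_ : (fun w => _) = A i j); first exact: measurable_funPT.
by apply/funext => w; rewrite mxE.
Qed.

End Measurability.

(** * Finite families of events *)

Section FiniteFamilies.
Context d (T : measurableType d) (R : realType) (P : probability T R).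

Definition pr (E : set T) : R := fine (P E).

Lemma prE (E : set T) : measurable E -> P E = (pr E)%:E.
Proof. by move=> mE; rewrite /pr fineK// fin_num_measure. Qed.

Lemma pr_ge0 (E : set T) : 0 <= pr E.
Proof. by rewrite /pr fine_ge0. Qed.

Lemma prT : pr setT = 1.
Proof. by rewrite /pr probability_setT. Qed.

(** Both sides are the expectations of the two step functions. *)
Lemma indicator_ineq (I J : finType) (c : I -> R) (F : I -> set T)
    (e : J -> R) (G : J -> set T) :
  (forall i, 0 <= c i) -> (forall i, measurable (F i)) ->
  (forall j, 0 <= e j) -> (forall j, measurable (G j)) ->
  (forall w, \sum_i c i * \1_(F i) w <= \sum_j e j * \1_(G j) w) ->
  \sum_i c i * pr (F i) <= \sum_j e j * pr (G j).
Proof.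
have sumE (K : finType) (a : K -> R) (H : K -> set T) :
    (forall i, 0 <= a i) -> (forall i, measurable (H i)) ->
    (\int[P]_w (\sum_i a i * \1_(H i) w)%:E = (\sum_i a i * pr (H i))%:E)%E.
  move=> a0 mH; under eq_integral do rewrite -sumEFin.
  have mi i : measurable_fun setT (fun w => (\1_(H i) w : R)%:E).
    by apply/measurable_EFinP; exact: measurable_indic.
  rewrite ge0_integral_sum//.
  - rewrite -sumEFin; apply: eq_bigr => i _.
    under eq_integral do rewrite EFinM.
    rewrite ge0_integralZl// ?lee_fin//.
    by rewrite integral_indic// setIT EFinM; congr (_ * _)%E; exact: prE.
  - move=> i; under eq_fun do rewrite EFinM.
    by apply: emeasurable_funM => //; exact: measurable_cst.
  - by move=> i w _; rewrite lee_fin mulr_ge0.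
move=> c0 mF e0 mG H; rewrite -lee_fin -!sumE//.
have mS (K : finType) (a : K -> R) (S : K -> set T) :
    (forall i, measurable (S i)) ->
    measurable_fun setT (fun w => (\sum_i a i * \1_(S i) w)%:E).
  move=> mS; apply/measurable_EFinP; apply: measurable_sum => i.
  by apply: measurable_funM => //; exact: measurable_indic.
apply: ge0_le_integral => //; [|exact: mS|exact: mS|].
  by move=> w _; rewrite lee_fin sumr_ge0// => i _; rewrite mulr_ge0.
by move=> w _; rewrite lee_fin.
Qed.

Lemma le_pr (E F : set T) : measurable E -> measurable F -> E `<=` F ->
  pr E <= pr F.
Proof.
by move=> mE mF EF; rewrite -lee_fin -!prE//; apply: le_measure => //; rewrite inE.
Qed.

Lemma pr_union_bound (I : finType) (D : pred I) (E : set T) (F : I -> set T) :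
  measurable E -> (forall i, measurable (F i)) ->
  (forall w, E w -> exists2 i, D i & F i w) ->
  pr E <= \sum_(i | D i) pr (F i).
Proof.
move=> mE mF EF.
have := @indicator_ineq 'I_1 I (fun=> 1) (fun=> E) (fun i => (D i)%:R) F.
rewrite big_ord1 mul1r (_ : \sum_j (D j)%:R * pr (F j) = \sum_(i | D i) pr (F i)).
  apply=> // w; rewrite big_ord1 mul1r indicE.
  have [wE|_] := boolP (w \in E); last first.
    by apply: sumr_ge0 => i _; rewrite mulr_ge0.
  have [i Di Fi] := EF _ (set_mem wE).
  rewrite (bigD1 i)//= Di indicE mem_set// mulr1 lerDl.
  by apply: sumr_ge0 => j _; rewrite mulr_ge0.
rewrite [RHS]big_mkcond; apply: eq_bigr => i _.
by rewrite mulr_natl mulrb.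
Qed.

(** With S the number of events that occur and mu its mean, integrate
    mu^2 1_N + 2 mu S <= mu^2 + S^2, which is (S - mu)^2 >= 0 where N fails and
    holds on N because S = 0 there. *)
Lemma second_moment (I : finType) (E : I -> set T) (N : set T) :
  measurable N -> (forall i, measurable (E i)) ->
  (forall w, N w -> forall i, ~ E i w) ->
  (\sum_i pr (E i)) ^+ 2 * pr N <=
  \sum_i \sum_j pr (E i `&` E j) - (\sum_i pr (E i)) ^+ 2.
Proof.
move=> mN mE NE; set mu := \sum_i pr (E i); have mu0 : 0 <= mu by apply: sumr_ge0 => i _; exact: pr_ge0.
have := @indicator_ineq ('I_1 + I)%type ('I_1 + I * I)%type
  (fun s => if s is inl _ then mu ^+ 2 else 2 * mu)
  (fun s => if s is inr i then E i else N)
  (fun s => if s is inl _ then mu ^+ 2 else 1)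
  (fun s => if s is inr p then E p.1 `&` E p.2 else setT).
rewrite !big_sumType /= !big_ord1 -mulr_sumr prT mulr1 -/mu.
rewrite (eq_bigr (fun p : I * I => pr (E p.1 `&` E p.2))) => [|p _]; last first.
  by rewrite mul1r.
rewrite -(pair_bigA _ (fun i j => pr (E i `&` E j)))/=.
move=> H; suff : mu ^+ 2 * pr N + 2 * mu * mu <=
  mu ^+ 2 + \sum_i \sum_j pr (E i `&` E j) by lra.
apply: H => [[_|i]|[_|i]|[_|[i j]]|[_|[i j]]|w] //=.
- exact: sqr_ge0.
- by rewrite mulr_ge0.
- exact: sqr_ge0.
- exact: measurableI.
rewrite !big_sumType /= !big_ord1 -mulr_sumr; set S := \sum_i \1_(E i) w.
have -> : \sum_(p : I * I) 1 * \1_(E p.1 `&` E p.2) w = S ^+ 2.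
  rewrite expr2 /S mulr_suml -(pair_bigA _ (fun i j => 1 * \1_(E i `&` E j) w))/=.
  apply: eq_bigr => i _; rewrite mulr_sumr; apply: eq_bigr => j _.
  by rewrite mul1r indicI.
rewrite [\1_setT w]indicE in_setT mulr1 indicE.
have [wN|_] := boolP (w \in N); last first.
  by rewrite mulr0; have := sqr_ge0 (mu - S); nra.
have -> : S = 0.
  rewrite /S big1// => i _; rewrite indicE memNset//.
  exact: NE (set_mem wN) i.
by rewrite mulr1 mulr0 expr0n.
Qed.

(** Independence is stated for subsets of the index type; this is its form for
    families indexed through an injection. *)
Lemma independent_reindex (I K : finType) (D : pred I) (X : I -> {RV P >-> R})
    (W : {set K}) (e : K -> I) (B : K -> set R) :
  mutually_independent D X ->
  {in W &, injective e} -> (forall i, i \in W -> D (e i)) ->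
  (forall i, measurable (B i)) ->
  pr (\bigcap_(i in [set i | i \in W]) (X (e i) @^-1` B i)) =
  \prod_(i in W) pr (X (e i) @^-1` B i).
Proof.
move=> indep einj De mB.
pose B' j := if [pick i in W | e i == j] is Some i then B i else setT.
have B'e i : i \in W -> B' (e i) = B i.
  move=> iW; rewrite /B'; case: pickP => [l /andP[lW /eqP eli]|/(_ i)].
    by rewrite (einj _ _ lW iW eli).
  by rewrite iW eqxx.
have mB' j : measurable (B' j).
  by rewrite /B'; case: pickP.
have := indep (e @: W)%SET B'.
rewrite big_imset//= => H.
rewrite /pr (_ : \bigcap_(i in _) _ = \bigcap_(j in [set j | j \in (e @: W)%SET])
   (X j @^-1` B' j)); last first.
  apply/seteqP; split => w /= wB.
    by move=> _ /imsetP[i iW ->]; rewrite B'e//; exact: wB.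
  by move=> i iW; rewrite /= -B'e//; exact: (wB _ (imset_f e iW)).
rewrite H//; last by move=> _ /imsetP[i iW ->]; exact: De.
transitivity (fine (\prod_(i in W) (pr (X (e i) @^-1` B i))%:E)%E).
  congr fine; apply: eq_bigr => i iW; rewrite B'e// prE//.
  exact: measurable_funPTI.
by rewrite prodEFin.
Qed.

End FiniteFamilies.

(** * Gaussian tails *)

Section GaussianTails.
Variable R : realType.

Lemma normal_pdf_expR (m s x : R) : 0 < s ->
  normal_pdf m s x = normal_peak s * expR (- ((x - m) ^+ 2 / (2 * s ^+ 2))).
Proof.
move=> s0; rewrite normal_pdfE ?gt_eqF// /normal_fun.
by rewrite mulNr mulr_natl.
Qed.

(** For x >= t >= 0 one has x^2 >= t^2 + (x - t)^2, and symmetrically for x <= - t,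
    so the tail of the centred density is dominated by a shifted density. *)
Lemma normal_pdf_shift (s t x : R) : 0 < s -> 0 <= t -> t <= `|x| ->
  normal_pdf 0 s x <=
  expR (- (t ^+ 2 / (2 * s ^+ 2))) * (normal_pdf t s x + normal_pdf (- t) s x).
Proof.
move=> s0 t0 tx.
have key u : t ^+ 2 + (x - u) ^+ 2 <= x ^+ 2 ->
    normal_pdf 0 s x <= expR (- (t ^+ 2 / (2 * s ^+ 2))) * normal_pdf u s x.
  move=> ux; rewrite !normal_pdf_expR// [leRHS]mulrCA ler_wpM2l ?normal_peak_ge0//.
  rewrite -expRD ler_expR subr0 -opprD lerN2 -mulrDl ler_wpM2r//.
  by rewrite invr_ge0 mulr_ge0// sqr_ge0.
have eu u : 0 <= expR (- (t ^+ 2 / (2 * s ^+ 2))) * normal_pdf u s x.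
  by rewrite mulr_ge0 ?expR_ge0 ?normal_pdf_ge0.
rewrite mulrDr; have [x0|x0] := leP 0 x.
  rewrite ger0_norm// in tx; apply: (le_trans (key t _)); first nra.
  by rewrite lerDl.
rewrite ltr0_norm// in tx; apply: (le_trans (key (- t) _)); first nra.
by rewrite lerDr.
Qed.

Lemma normal_prob_tail (s t : R) (B : set R) : 0 < s -> 0 <= t -> measurable B ->
  (forall x, B x -> t <= `|x|) ->
  (normal_prob 0 s B <= (2 * expR (- (t ^+ 2 / (2 * s ^+ 2))))%:E)%E.
Proof.
move=> s0 t0 mB Bt; set e := expR _; have e0 : 0 <= e by exact: expR_ge0.
have mpdf u : measurable_fun setT (fun x => (normal_pdf u s x)%:E).
  by apply/measurable_EFinP; exact: measurable_normal_pdf.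
pose f x := (e%:E * ((normal_pdf t s x)%:E + (normal_pdf (- t) s x)%:E))%E.
have f0 x : (0 <= f x)%E.
  by rewrite /f -EFinD -EFinM lee_fin mulr_ge0// addr_ge0// normal_pdf_ge0.
have msum : measurable_fun setT
    (fun x => ((normal_pdf t s x)%:E + (normal_pdf (- t) s x)%:E)%E).
  exact: emeasurable_funD.
have mf : measurable_fun setT f.
  by apply: emeasurable_funM => //; exact: measurable_cst.
apply: (@le_trans _ _ (\int[lebesgue_measure]_(x in B) f x)%E).
  apply: ge0_le_integral => //.
  - by move=> x _; rewrite lee_fin normal_pdf_ge0.
  - exact: (measurable_funTS (mpdf 0)).
  - exact: (measurable_funTS mf).
  - move=> x Bx; rewrite /f -EFinD -EFinM lee_fin.
    by apply: normal_pdf_shift => //; exact: Bt.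
apply: (@le_trans _ _ (\int[lebesgue_measure]_x f x)%E).
  exact: ge0_subset_integral.
rewrite /f ge0_integralZl ?lee_fin//; last first.
  by move=> x _; rewrite -EFinD lee_fin addr_ge0// normal_pdf_ge0.
rewrite ge0_integralD//.
- rewrite !integral_normal_pdf -EFinD -EFinM lee_fin.
  by rewrite mulrC.
- by move=> x _; rewrite lee_fin normal_pdf_ge0.
- exact: mpdf.
- by move=> x _; rewrite lee_fin normal_pdf_ge0.
- exact: mpdf.
Qed.

(** Bound the density from below on [t, t + 1] and use
    (t + 1)^2 <= (1 + eta) t^2 + 1 + 1 / eta. Losing a factor 1 + eta in the
    exponent instead of a polynomial prefactor keeps every later estimate a pure
    power of n. *)
Lemma normal_prob_tail_lb (s eta : R) : 0 < s -> 0 < eta ->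
  exists2 c, 0 < c & forall t, 0 <= t ->
    ((c * expR (- ((1 + eta) * (t ^+ 2 / (2 * s ^+ 2)))))%:E <=
     normal_prob 0 s `[t, +oo[%classic)%E.
Proof.
move=> s0 eta0; pose c := normal_peak s * expR (- ((1 + eta^-1) / (2 * s ^+ 2))).
have c0 : 0 < c by rewrite mulr_gt0 ?expR_gt0// normal_peak_gt0 ?gt_eqF.
exists c => // t t0; pose v := c * expR (- ((1 + eta) * (t ^+ 2 / (2 * s ^+ 2)))).
have mpdf : measurable_fun setT (fun x => (normal_pdf 0 s x)%:E).
  by apply/measurable_EFinP; exact: measurable_normal_pdf.
have pdf0 (x : R) : (0 <= (normal_pdf 0 s x)%:E)%E.
  by rewrite lee_fin normal_pdf_ge0.
pose D : set R := `[t, t + 1]%classic.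
have mD : measurable D by exact: measurable_itv.
apply: (@le_trans _ _ (\int[lebesgue_measure]_(x in D) cst v%:E x)%E).
  rewrite integral_cst//= lebesgue_measure_itv/= lte_fin ltrDl ltr01.
  by rewrite -EFinB addrAC subrr add0r mule1.
apply: (@le_trans _ _ (\int[lebesgue_measure]_(x in D) (normal_pdf 0 s x)%:E)%E).
  apply: ge0_le_integral => //.
  - move=> x _; rewrite lee_fin mulr_ge0 ?expR_ge0//; exact: ltW.
  - exact: (measurable_funTS mpdf).
  - move=> x; rewrite /D /= in_itv/= => /andP[tx xt]; rewrite lee_fin.
    rewrite normal_pdf_expR// /v /c -mulrA ler_wpM2l ?normal_peak_ge0//.
    rewrite -expRD ler_expR -opprD lerN2 subr0 [X in _ <= _ + X]mulrA -mulrDl ler_wpM2r//.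
      by rewrite invr_ge0 mulr_ge0// sqr_ge0.
    have et : 2 * t <= eta * t ^+ 2 + eta^-1.
      have := sqr_ge0 (eta * t - 1).
      rewrite -(pmulr_rge0 _ (_ : 0 < eta^-1)) ?invr_gt0//.
      have -> : eta^-1 * (eta * t - 1) ^+ 2 = eta * t ^+ 2 + eta^-1 - 2 * t by field; rewrite gt_eqF.
      lra.
    nra.
apply: ge0_subset_integral => //; first exact: (measurable_funTS mpdf).
by move=> x; rewrite /D /= !in_itv/= andbT => /andP[].
Qed.

Context d (T : measurableType d) (P : probability T R).

Lemma normal_law_sq_tail (X : {RV P >-> R}) (s t : R) : 0 < s -> 0 <= t ->
  has_normal_law X 0 s ->
  pr P (X @^-1` [set x | t <= x ^+ 2 / s ^+ 2]) <= 2 * expR (- (t / 2)).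
Proof.
move=> s0 t0 XN; have s20 : 0 < s ^+ 2 by rewrite exprn_gt0.
have mB : measurable [set x : R | t <= x ^+ 2 / s ^+ 2].
  rewrite -[X in measurable X]setTI -preimage_itvcy.
  by apply: measurable_funM => //; apply: measurable_funX.
rewrite -lee_fin -prE; last exact: measurable_funPTI.
rewrite -[P _]/(distribution P X _) XN//.
have -> : t / 2 = (s * Num.sqrt t) ^+ 2 / (2 * s ^+ 2).
  by rewrite exprMn sqr_sqrtr//; field; rewrite gt_eqF.
apply: normal_prob_tail => //; first by rewrite mulr_ge0 ?sqrtr_ge0 ?ltW.
move=> x /=; rewrite ler_pdivlMr// => tx.
rewrite -(@ler_pXn2r _ 2)// ?nnegrE ?normr_ge0//; last first.
  by rewrite mulr_ge0 ?sqrtr_ge0 ?ltW.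
by rewrite exprMn sqr_sqrtr// real_normK ?num_real// mulrC.
Qed.

End GaussianTails.

(** * Large deviations of sums of Gaussian squares *)

Section SumOfSquaresTail.
Context d (T : measurableType d) (R : realType) (P : probability T R).

Lemma grid_cell (N : nat) (y : R) : 0 <= y ->
  exists m : 'I_N.+1, m%:R <= y /\ (m = N :> nat \/ y < m%:R + 1).
Proof.
move=> y0; have /andP[h1 h2] := truncn_itv y0.
have [yN|Ny] := leqP (Num.truncn y) N.
  have yN' : (Num.truncn y < N.+1)%N by [].
  by exists (Ordinal yN') => /=; split => //; right; rewrite -natr1 in h2.
exists ord_max; split; last by left.
by apply: le_trans h1; rewrite ler_nat ltnW.
Qed.

(** Round y / T0 down to multiples of 1 / N, truncated at 1. Either some coordinate
    reaches 1, or rounding loses at most #|K| / N <= th - 1 in total; in both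
    cases the rounded values sum to at least 1. *)
Lemma grid_cover (K : finType) (W : {set K}) (N : nat) (y : K -> R) (T0 th : R) :
  (0 < N)%N -> 0 < T0 -> #|K|%:R <= (th - 1) * N%:R ->
  (forall i, 0 <= y i) -> th * T0 <= \sum_(i in W) y i ->
  exists m : {ffun K -> 'I_N.+1}, (N <= \sum_(i in W) m i)%N /\
    forall i, (m i)%:R * (T0 / N%:R) <= y i.
Proof.
move=> N0 T00 KN y0 yT; have NR : 0 < N%:R :> R by rewrite ltr0n.
have z0 i : 0 <= y i * (N%:R / T0) by rewrite mulr_ge0// divr_ge0 ?ltW.
have [m mP] := choice (fun i => grid_cell N (z0 i)).
exists [ffun i => m i]; split; last first.
  move=> i; rewrite ffunE; have [h _] := mP i.
  by rewrite -invf_div ler_pdivrMr// divr_gt0.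
under eq_bigr do rewrite ffunE.
have [/existsP[i /andP[iW /eqP mi]]|/existsPn mN] :=
  boolP [exists i, (i \in W) && (m i == N :> nat)].
  by rewrite (bigD1 i)//= mi leq_addr.
rewrite -(ler_nat R) natr_sum.
have h1 : \sum_(i in W) (y i * (N%:R / T0) - 1) <= \sum_(i in W) (m i)%:R.
  apply: ler_sum => i iW; have [_ [mi|]] := mP i; last lra.
  by have := mN i; rewrite iW /= mi eqxx.
apply: le_trans h1; rewrite sumrB -mulr_suml sumr_const.
have h2 : th * N%:R <= (\sum_(i in W) y i) * (N%:R / T0).
  rewrite mulrA ler_pdivlMr// mulrAC ler_wpM2r//; exact: ltW.
have h3 : #|W|%:R <= #|K|%:R :> R by rewrite ler_nat max_card.
move: h3 h2 KN; lra.
Qed.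

(** By rounding, the event is covered by boundedly many product events, one for
    each grid point m with total mass at least 1, and each of them has probability
    at most 2^#|K| exp (- (T0 / 2) (sum of m) / N). Only the product rule for
    events is used, and no exponential moment of a sum. *)
Lemma sum_squares_tail (K : finType) (W : {set K}) (X : K -> {RV P >-> R})
    (s : K -> R) (N : nat) (th T0 : R) :
  (forall i, 0 < s i) -> (forall i, i \in W -> has_normal_law (X i) 0 (s i)) ->
  (forall B : K -> set R, (forall i, measurable (B i)) ->
    pr P (\bigcap_(i in [set i | i \in W]) (X i @^-1` B i)) =
    \prod_(i in W) pr P (X i @^-1` B i)) ->
  (0 < N)%N -> 0 < T0 -> #|K|%:R <= (th - 1) * N%:R ->
  pr P [set w | th * T0 <= \sum_(i in W) X i w ^+ 2 / s i ^+ 2] <=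
  (N.+1 ^ #|K|)%:R * 2 ^+ #|K| * expR (- (T0 / 2)).
Proof.
move=> s0 XN indep N0 T00 KN; have NR : 0 < N%:R :> R by rewrite ltr0n.
pose B (m : {ffun K -> 'I_N.+1}) i :=
  [set x : R | (m i)%:R * (T0 / N%:R) <= x ^+ 2 / s i ^+ 2].
have mB m i : measurable (B m i).
  rewrite /B -[X in measurable X]setTI -preimage_itvcy.
  by apply: measurable_funM => //; apply: measurable_funX.
pose F m := \bigcap_(i in [set i | i \in W]) (X i @^-1` B m i).
have mF m : measurable (F m).
  by apply: fin_bigcap_measurable => // i _; exact: measurable_funPTI.
have mE : measurable [set w | th * T0 <= \sum_(i in W) X i w ^+ 2 / s i ^+ 2].
  rewrite -[X in measurable X]setTI -preimage_itvcy.
  under eq_fun do rewrite big_mkcond /=.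
  suff mS : measurable_fun setT
      (fun w => \sum_i if i \in W then X i w ^+ 2 / s i ^+ 2 else 0).
    exact: mS.
  apply: measurable_sum => i; case: (i \in W) => //.
  by apply: measurable_funM => //; exact: measurable_funX.
pose D (m : {ffun K -> 'I_N.+1}) := (N <= \sum_(i in W) m i)%N.
apply: (@le_trans _ _ (\sum_(m | D m) pr P (F m))).
  apply: pr_union_bound => // w /= Ew; have [i|m [mN mX]] := @grid_cover _ W N
    (fun i => X i w ^+ 2 / s i ^+ 2) T0 th N0 T00 KN _ Ew.
    by rewrite divr_ge0 ?sqr_ge0.
  by exists m => // i _ /=; exact: mX.
have Fle m : D m -> pr P (F m) <= 2 ^+ #|K| * expR (- (T0 / 2)).
  move=> mN; rewrite indep//.
  apply: (@le_trans _ _ (\prod_(i in W) (2 * expR (- ((m i)%:R * (T0 / N%:R) / 2))))).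
    apply: ler_prod => i iW; rewrite pr_ge0 /=.
    apply: normal_law_sq_tail => //; last exact: XN.
    by rewrite mulr_ge0// divr_ge0 ?ltW.
  rewrite big_split /= prodr_const -expR_sum; apply: ler_pM.
  - by rewrite exprn_ge0.
  - exact: expR_ge0.
  - by rewrite ler_weXn2l ?max_card// ler1n.
  rewrite ler_expR sumrN lerN2 -mulr_suml -mulr_suml ler_wpM2r//.
  rewrite mulrA ler_pdivlMr// mulrC ler_wpM2r ?(ltW T00)// -natr_sum ler_nat.
  exact: mN.
apply: (le_trans (ler_sum _ Fle)).
rewrite sumr_const -[X in X <= _]mulr_natl -mulrA ler_wpM2r ?mulr_ge0 ?exprn_ge0 ?expR_ge0//.
rewrite ler_nat (leq_trans (max_card _))// card_ffun card_ord//.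
Qed.

End SumOfSquaresTail.

(** * Upper bound by first moments *)

Section UpperBound.
Variable R : realType.

Definition scale (n : nat) : R := Num.sqrt (2 * ln n%:R).

Lemma ln_nat_gt0 n : (1 < n)%N -> 0 < ln n%:R :> R.
Proof. by move=> n1; apply: ln_gt0; rewrite ltr1n. Qed.

Lemma scale_gt0 n : (1 < n)%N -> 0 < scale n.
Proof. by move=> n1; rewrite sqrtr_gt0 mulr_gt0// ln_nat_gt0. Qed.

Lemma scale_sqr n : (1 < n)%N -> scale n ^+ 2 = 2 * ln n%:R.
Proof. by move=> n1; rewrite sqr_sqrtr// mulr_ge0// ltW// ln_nat_gt0. Qed.

Definition increasing_on k n (U : {set 'I_k}) (g : 'I_k -> 'I_n) :=
  {in U &, {homo g : i j / (i < j)%N}}.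

Section Embedding.
Context d (T : measurableType d) (P : probability T R).
Variables (n k : nat) (alpha : R) (A : 'I_n -> 'I_n -> {RV P >-> R}).
Hypothesis gA : gaussian_symmetric alpha A.

Lemma random_matrix_sym w : (random_matrix A w)^T = random_matrix A w.
Proof. by case: gA => Asym _ _ _; apply/matrixP => i j; rewrite !mxE Asym. Qed.

Lemma upairs_increasing U (g : 'I_k -> 'I_n) p : increasing_on U g ->
  p \in upairs U -> (g p.1 <= g p.2)%N.
Proof.
move=> gU; rewrite inE => /and3P[p1 p2]; rewrite leq_eqVlt => /orP[/eqP p12|p12].
  by rewrite (val_inj p12).
exact/ltnW/gU.
Qed.

Lemma increasing_on_inj U (g : 'I_k -> 'I_n) : increasing_on U g ->
  {in U &, injective g}.
Proof.
move=> gU i j iU jU gij; apply: val_inj; have [ij|ji|//] := ltngtP i j.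
  by have := gU _ _ iU jU ij; rewrite gij ltnn.
by have := gU _ _ jU iU ji; rewrite gij ltnn.
Qed.

Lemma entry_law U (g : 'I_k -> 'I_n) p : increasing_on U g -> p \in upairs U ->
  has_normal_law (A (g p.1) (g p.2)) 0 (entry_scale alpha p).
Proof.
case: gA => _ offd diag _ gU; rewrite inE /entry_scale => /and3P[p1 p2].
by case: eqP => [->|/eqP p12] le12//; apply/offd/gU => //; rewrite ltn_neqAle p12.
Qed.

Lemma entry_scale_sqr p : entry_scale (m := k) alpha p ^+ 2 = entry_scale (alpha ^+ 2) p.
Proof. by rewrite /entry_scale; case: eqP => // _; rewrite expr1n. Qed.

(** The exponent is s #|U|, strictly above the number #|U| of vertices to be
    chosen, whereas the energy threshold carries s^2: one factor s is
    the rounding loss th allowed by sum_squares_tail. *)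
Lemma energy_tail (U : {set 'I_k}) (g : 'I_k -> 'I_n) (s : R) (N : nat) :
  0 < alpha -> 1 < s -> (1 < n)%N -> (0 < #|U|)%N ->
  (0 < N)%N -> (k * k)%:R <= (s - 1) * N%:R -> increasing_on U g ->
  pr P [set w | #|U|%:R * (s * scale n) ^+ 2 <=
                \sum_(p in upairs U) A (g p.1) (g p.2) w ^+ 2 / entry_scale alpha p ^+ 2]
  <= (N.+1 ^ (k * k))%:R * 2 ^+ (k * k) * expR (- (s * #|U|%:R * ln n%:R)).
Proof.
move=> a0 s1 n1 U0 N0 kN gU.
have cK : #|{: 'I_k * 'I_k}| = (k * k)%N by rewrite card_prod card_ord.
pose T0 := s * #|U|%:R * scale n ^+ 2.
have UR : 0 < #|U|%:R :> R by rewrite ltr0n.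
have -> : #|U|%:R * (s * scale n) ^+ 2 = s * T0 by rewrite /T0; ring.
have -> : s * #|U|%:R * ln n%:R = T0 / 2 by rewrite /T0 scale_sqr//; field.
rewrite -cK.
apply: (@sum_squares_tail _ _ _ P _ (upairs U) (fun p => A (g p.1) (g p.2))
  (fun p => entry_scale alpha p)) => //.
- by move=> p; exact: entry_scale_gt0.
- by move=> p; exact: entry_law.
- move=> B mB; case: gA => _ _ _ indep.
  apply: (independent_reindex (e := fun p => (g p.1, g p.2)) indep) => //.
    move=> [i j] [i' j']; rewrite !inE /= => /and3P[iU jU _] /and3P[i'U j'U _] [gi gj].
    by rewrite (increasing_on_inj gU iU i'U gi) (increasing_on_inj gU jU j'U gj).
  by move=> p pU /=; exact: upairs_increasing pU.
- by rewrite mulr_gt0 ?exprn_gt0 ?scale_gt0// mulr_gt0//; lra.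
- by rewrite cK.
Qed.

End Embedding.

(** For each U the union bound runs over the n^#|U| placements of U only, and not
    over the n^k placements of all the positions: placements are functions with
    the default value i0 outside U. Each has probability O(n^(- s #|U|)). *)
Lemma sparse_max_upper (k : nat) (alpha s : R) : (0 < k)%N -> 0 < alpha -> 1 < s ->
  exists C : R, forall d (T : measurableType d) (P : probability T R) n
    (A : 'I_n -> 'I_n -> {RV P >-> R}), (k <= n)%N -> (1 < n)%N ->
    gaussian_symmetric alpha A ->
    pr P [set w | gamma_max k (alpha ^+ 2) * (s * scale n) <
                  sparse_max k (random_matrix A w)] <=
    C * expR (- ((s - 1) * ln n%:R)).
Proof.
move=> k0 a0 s1; pose N := (Num.truncn ((k * k)%:R / (s - 1) : R)).+1.
have sB1 : 0 < s - 1 by lra.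
have kN : (k * k)%:R <= (s - 1) * N%:R.
  by rewrite mulrC -ler_pdivrMr//; apply/ltW/truncnS_gt.
pose C0 : R := (N.+1 ^ (k * k))%:R * 2 ^+ (k * k).
have C00 : 0 <= C0 by rewrite mulr_ge0// exprn_ge0.
exists (#|{set 'I_k}|%:R * C0) => d T P n A kn n1 gA.
have n0 : (0 < n)%N by exact: ltnW.
have lnn : 0 < ln n%:R :> R by exact: ln_nat_gt0.
pose i0 : 'I_n := Ordinal n0.
pose inc (U : {set 'I_k}) (g : 'I_k -> 'I_n) :=
  [forall i in U, forall j in U, (i < j)%N ==> (g i < g j)%N].
have incP U g : reflect (increasing_on U g) (inc U g).
  apply: (iffP forall_inP) => [H i j iU jU ij|H i iU].
    by have /forall_inP/(_ j jU)/implyP := H i iU; exact.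
  by apply/forall_inP => j jU; apply/implyP; exact: H.
pose F (Ug : {set 'I_k} * {ffun 'I_k -> 'I_n}) := [set w | #|Ug.1|%:R * (s * scale n) ^+ 2 <=
   \sum_(p in upairs Ug.1) A (Ug.2 p.1) (Ug.2 p.2) w ^+ 2 / entry_scale alpha p ^+ 2].
have mF Ug : measurable (F Ug).
  rewrite /F -[X in measurable X]setTI -preimage_itvcy.
  under eq_fun do rewrite big_mkcond /=.
  suff mS : measurable_fun setT (fun w => \sum_p if p \in upairs Ug.1
      then A (Ug.2 p.1) (Ug.2 p.2) w ^+ 2 / entry_scale alpha p ^+ 2 else 0).
    exact: mS.
  apply: measurable_sum => p; case: (p \in upairs _) => //.
  by apply: measurable_funM => //; exact: measurable_funX.
pose D (Ug : {set 'I_k} * {ffun 'I_k -> 'I_n}) := (0 < #|Ug.1|)%N &&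
  ((Ug.2 \in pffun_on i0 (mem Ug.1) predT) && inc Ug.1 Ug.2).
have mM := measurable_sparse_max_random A k0 n0.
apply: (@le_trans _ _ (\sum_(Ug | D Ug) pr P (F Ug))).
  apply: pr_union_bound => //.
    by rewrite -[X in measurable X]setTI -preimage_itvoy; exact: mM.
  move=> w /= Mw; have := sparse_max_gt_energy k0 kn (exprn_gt0 2 a0)
    (mulr_gt0 (lt_trans ltr01 s1) (scale_gt0 n1)) (random_matrix_sym gA w) Mw.
  move=> [f [U [fmono U0]]]; rewrite energyE => EU.
  pose g := [ffun i => if i \in U then f i else i0].
  have gE i : i \in U -> g i = f i by rewrite ffunE => ->.
  exists (U, g); rewrite /D /F/= ?U0/=.
    apply/andP; split.
      apply/pfamilyP; split => [|i iU]; last by [].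
      by apply/supportP => i iU; rewrite ffunE (negbTE iU).
    by apply/incP => i j iU jU ij; rewrite !gE// fmono.
  apply/ltW; apply: (lt_le_trans EU); apply: ler_sum => p pU.
  have /and3P[p1 p2 _] : [&& p.1 \in U, p.2 \in U & (p.1 <= p.2)%N].
    by move: pU; rewrite inE.
  by rewrite !mxE !gE// entry_scale_sqr.
rewrite -(pair_big_dep (fun U : {set 'I_k} => 0 < #|U|)%N
  (fun U g => (g \in pffun_on i0 (mem U) predT) && inc U g)
  (fun U g => pr P (F (U, g))))/=.
have -> : #|{set 'I_k}|%:R * C0 * expR (- ((s - 1) * ln n%:R)) =
   \sum_(U : {set 'I_k}) C0 * expR (- ((s - 1) * ln n%:R)).
  by rewrite sumr_const -[RHS]mulr_natl mulrA.
rewrite big_mkcond /=; apply: ler_sum => U _.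
case: ifPn => [U0|_]; last by rewrite mulr_ge0 ?expR_ge0.
have UR : 1 <= #|U|%:R :> R by rewrite ler1n.
apply: (@le_trans _ _ (\sum_(g in pffun_on i0 (mem U) predT)
    C0 * expR (- (s * #|U|%:R * ln n%:R)))).
  rewrite big_mkcondr /=; apply: ler_sum => g gU.
  case: ifPn => [/incP gi|_]; last by rewrite mulr_ge0 ?expR_ge0.
  exact: energy_tail.
rewrite sumr_const card_pffun_on -[X in X <= _]mulr_natl [X in X <= _]mulrCA ler_wpM2l//.
have -> : #|'I_n| = n by rewrite card_ord.
rewrite natrX -[n%:R]lnK ?posrE ?ltr0n// -expRM_natl -expRD ler_expR lnK ?posrE ?ltr0n//.
have : 0 <= (s - 1) * ln n%:R * (#|U|%:R - 1).
  by rewrite mulr_ge0 ?subr_ge0// mulr_ge0// ltW.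
lra.
Qed.

End UpperBound.

(** * Lower bound by second moments *)

Section LowerBound.
Variable R : realType.

Section BlockTuples.
Context d (T : measurableType d) (P : probability T R).
Variables (n k m : nat) (alpha : R) (A : 'I_n -> 'I_n -> {RV P >-> R}).
Hypothesis gA : gaussian_symmetric alpha A.
Hypothesis km_n : (k * m <= n)%N.

Lemma block_index_lt (a : 'I_k) (t : 'I_m) : (a * m + t < n)%N.
Proof.
apply: leq_trans km_n; apply: (@leq_trans (a.+1 * m)%N).
  by rewrite mulSn addnC ltn_add2r.
by rewrite leq_mul2r ltn_ord orbT.
Qed.

(** Position a of a tuple is drawn from the a-th block of m consecutive vertices, so
    two tuples share a matrix entry only where they agree at both positions, and
    ordered positions give ordered vertices. *)
Definition block_index (a : 'I_k) (t : 'I_m) : 'I_n := Ordinal (block_index_lt a t).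

Lemma block_index_ltn (a b : 'I_k) (t u : 'I_m) : (a < b)%N -> (block_index a t < block_index b u)%N.
Proof.
move=> ab /=; apply: (@leq_trans (a.+1 * m)%N); first by rewrite mulSn addnC ltn_add2r.
by apply: (@leq_trans (b * m)%N); rewrite ?leq_addr// leq_mul2r ab orbT.
Qed.

Lemma block_index_inj a b t u : block_index a t = block_index b u -> a = b /\ t = u.
Proof.
move=> abtu; have ab : a = b.
  apply: val_inj; have [ab|ba|//] := ltngtP a b.
    by have := block_index_ltn t u ab; rewrite abtu ltnn.
  by have := block_index_ltn u t ba; rewrite abtu ltnn.
split=> //; rewrite ab in abtu; apply: val_inj.
by have /(congr1 val)/= /addnI := abtu.
Qed.

Variable c : 'I_k * 'I_k -> R.

Definition tuple_event (tau : {ffun 'I_k -> 'I_m}) : set T :=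
  \bigcap_(p in [set p | p \in upairs [set: 'I_k]%SET])
    (A (block_index p.1 (tau p.1)) (block_index p.2 (tau p.2)) @^-1` `[c p, +oo[%classic).

Definition entry_pr p : R := fine (normal_prob 0 (entry_scale alpha p) `[c p, +oo[%classic).

Lemma measurable_tuple_event tau : measurable (tuple_event tau).
Proof.
apply: fin_bigcap_measurable => // p _.
by apply: measurable_funPTI; exact: measurable_itv.
Qed.

Lemma block_entry_pr (tau : {ffun 'I_k -> 'I_m}) (p : 'I_k * 'I_k) : (p.1 <= p.2)%N ->
  pr P (A (block_index p.1 (tau p.1)) (block_index p.2 (tau p.2))
     @^-1` `[c p, +oo[%classic) = entry_pr p.
Proof.
move=> p12; have [_ offd diag _] := gA; rewrite /pr /entry_pr; congr fine.
have mI : measurable (`[c p, +oo[%classic : set R) by exact: measurable_itv.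
rewrite /entry_scale; case: eqP => [<-|/eqP p12'].
  exact: diag.
by apply: offd => //; apply: block_index_ltn; rewrite ltn_neqAle p12'.
Qed.

Definition agree (tau tau' : {ffun 'I_k -> 'I_m}) : {set 'I_k} :=
  [set i | tau i == tau' i].

Lemma block_index_le (tau tau' : {ffun 'I_k -> 'I_m}) (p : 'I_k * 'I_k) :
  (p.1 <= p.2)%N -> (block_index p.1 (tau p.1) <= block_index p.2 (tau p.2))%N.
Proof.
rewrite leq_eqVlt => /orP[/eqP/val_inj ->//|p12].
exact/ltnW/block_index_ltn.
Qed.

Lemma pr_tuple_event tau :
  pr P (tuple_event tau) = \prod_(p in upairs [set: 'I_k]%SET) entry_pr p.
Proof.
have [_ _ _ indep] := gA.
rewrite /tuple_event (independent_reindex (B := fun p => `[c p, +oo[%classic)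
  (e := fun p => (block_index p.1 (tau p.1), block_index p.2 (tau p.2))) indep).
- by apply: eq_bigr => p; rewrite !inE/= => p12; exact: block_entry_pr.
- move=> [i j] [i' j'] _ _ /= [/(congr1 (fun x : nat => x))].
  move=> /= h1 h2.
  have [//|<- _] := @block_index_inj i i' (tau i) (tau i'); first exact: val_inj.
  by have [//|<- _] := @block_index_inj j j' (tau j) (tau j'); first exact: val_inj.
- by move=> p; rewrite !inE /=; exact: block_index_le.
- by move=> p; exact: measurable_itv.
Qed.

(** The entries common to two block tuples are those indexed by pairs of
    positions where the tuples agree. *)
Lemma pr_tuple_eventI tau tau' :
  pr P (tuple_event tau `&` tuple_event tau') *
    \prod_(p in upairs (agree tau tau')) entry_pr p =
  (\prod_(p in upairs [set: 'I_k]%SET) entry_pr p) ^+ 2.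
Proof.
have [_ _ _ indep] := gA; set U := agree tau tau'.
pose K := ('I_k * 'I_k + 'I_k * 'I_k)%type.
pose W : {set K} := [set x | match x with
  | inl p => p \in upairs [set: 'I_k]%SET
  | inr p => (p \in upairs [set: 'I_k]%SET) && (p \notin upairs U) end]%SET.
pose e (x : K) := match x with
  | inl p => (block_index p.1 (tau p.1), block_index p.2 (tau p.2))
  | inr p => (block_index p.1 (tau' p.1), block_index p.2 (tau' p.2)) end.
pose B (x : K) : set R := match x with inl p | inr p => `[c p, +oo[%classic end.
have -> : tuple_event tau `&` tuple_event tau' =
    \bigcap_(x in [set x | x \in W]) (A (e x).1 (e x).2 @^-1` B x).
  apply/seteqP; split => [w [w1 w2] [] p|w wW].
  - by rewrite /= inE => pU; exact: w1.
  - by rewrite /= inE => /andP[pU _]; exact: w2.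
  split => p /= pU; first by apply: (wW (inl p)); rewrite /= inE.
  (* Where the tuples agree, the condition for tau' is the one for tau. *)
  have [pU'|pU'] := boolP (p \in upairs U); last first.
    by apply: (wW (inr p)); rewrite /= inE pU.
  have : (A (e (inl p)).1 (e (inl p)).2 @^-1` B (inl p)) w.
    by apply: (wW (inl p)); rewrite /= inE.
  move: pU'; rewrite inE => /and3P[]; rewrite !inE /= => /eqP -> /eqP -> _.
  by [].
rewrite (independent_reindex (e := e) indep); first last.
- by case=> p; exact: measurable_itv.
- case=> p; rewrite !inE /=; first exact: block_index_le.
  by move=> /andP[p12 _]; exact: block_index_le.
- have eqtau t (p p' : 'I_k * 'I_k) :
      (block_index p.1 (t p.1), block_index p.2 (t p.2)) =
      (block_index p'.1 (t p'.1), block_index p'.2 (t p'.2)) -> p = p'.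
    move: p p' => [i j] [i' j'] /= [h1 h2].
    have [//|<- _] := @block_index_inj i i' (t i) (t i'); first exact: val_inj.
    by have [//|<- _] := @block_index_inj j j' (t j) (t j'); first exact: val_inj.
  have cross (p p' : 'I_k * 'I_k) :
      (block_index p.1 (tau p.1), block_index p.2 (tau p.2)) =
      (block_index p'.1 (tau' p'.1), block_index p'.2 (tau' p'.2)) ->
      p' \in upairs [set: 'I_k]%SET -> p' \in upairs U.
    move: p p' => [i j] [i' j'] /= [h1 h2].
    have [//|ii' t1] := @block_index_inj i i' (tau i) (tau' i'); first exact: val_inj.
    have [//|jj' t2] := @block_index_inj j j' (tau j) (tau' j'); first exact: val_inj.
    by rewrite !inE /= -ii' -jj' in t1 t2 *; rewrite t1 t2 !eqxx.
  move=> [p|p] [p'|p']; rewrite !inE /=.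
  + by move=> _ _ /eqtau ->.
  + by move=> _ /andP[p'T p'U] /cross; rewrite !inE p'T => /(_ isT); rewrite p'T in p'U; rewrite (negbTE p'U).
  + by move=> /andP[pT pU] _ /esym/cross; rewrite !inE pT => /(_ isT); rewrite pT in pU; rewrite (negbTE pU).
  + by move=> _ _ /eqtau ->.
rewrite big_sumType /= expr2 -mulrA; congr (_ * _).
  under eq_bigl do rewrite inE.
  by apply: eq_bigr => p; rewrite !inE/= => p12; exact: block_entry_pr.
rewrite [RHS](bigID (fun p => p \in upairs U))/= mulrC; congr (_ * _).
  apply: eq_bigl => p; rewrite !inE /=.
  by case: (p.1 <= p.2)%N; rewrite ?andbF ?andbT.
under eq_bigl do rewrite inE.
by apply: eq_bigr => p; rewrite !inE/= => /andP[p12 _]; exact: block_entry_pr.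
Qed.

Lemma count_agree (tau : {ffun 'I_k -> 'I_m}) (U : {set 'I_k}) :
  (#|[set tau' | agree tau tau' == U]%SET| <= m ^ (k - #|U|))%N.
Proof.
pose F i : pred 'I_m := if i \in U then pred1 (tau i) else predT.
apply: (@leq_trans #|family F|).
  apply/subset_leq_card/fintype.subsetP => tau'; rewrite inE => /eqP tU.
  apply/familyP => i; rewrite /F; case: ifPn => //.
  by rewrite -tU inE eq_sym.
rewrite card_family foldrE big_map big_enum /=.
rewrite (bigID (mem U))/= big1 ?mul1n; last first.
  by move=> i iU; rewrite /F iU card1.
rewrite (eq_bigr (fun=> m)); last first.
  by move=> i /negbTE iU; rewrite /F iU card_ord.
rewrite prod_nat_const leq_eqVlt; apply/orP; left; apply/eqP; congr (_ ^ _)%N.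
have -> : (k - #|U|)%N = #|~: U| by rewrite -(addKn #|U| #|~: U|) cardsC card_ord.
by apply: eq_card => i; rewrite !inE.
Qed.

(** Second moment method: the pairs of tuples that agree exactly on U are at most
    m^k m^(k - #|U|) in number, and their correlation costs the inverse of the
    probability of the pattern on U. The term U = set0 is at most the squared
    mean. *)
Lemma pr_no_tuple_event : (0 < m)%N -> (forall p, 0 < entry_pr p) ->
  pr P (\bigcap_tau ~` tuple_event tau) <=
  \sum_(U : {set 'I_k} | (0 < #|U|)%N)
    (m%:R ^+ #|U|)^-1 * (\prod_(p in upairs U) entry_pr p)^-1.
Proof.
move=> m0 q0; pose Q U := \prod_(p in upairs U) entry_pr p.
have Q0 (U : {set 'I_k}) : 0 < Q U by apply: prodr_gt0.
have mR : 0 < m%:R :> R by rewrite ltr0n.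
pose QT := Q [set: 'I_k]%SET.
have mN : measurable (\bigcap_tau ~` tuple_event tau).
  apply: fin_bigcap_measurable => // tau _.
  exact/measurableC/measurable_tuple_event.
have := second_moment P mN measurable_tuple_event (fun w wN tau => wN tau I).
have mu_E : \sum_tau pr P (tuple_event tau) = m%:R ^+ k * QT.
  under eq_bigr do rewrite pr_tuple_event.
  by rewrite sumr_const card_ffun !card_ord -natrX mulr_natl.
have pair_E tau tau' : pr P (tuple_event tau `&` tuple_event tau') =
    QT ^+ 2 / Q (agree tau tau').
  by rewrite /QT /Q -(pr_tuple_eventI tau tau') mulfK// gt_eqF//; exact: Q0.
have muP : 0 < (m%:R ^+ k * QT) ^+ 2.
  by rewrite exprn_gt0// mulr_gt0// ?exprn_gt0//; exact: Q0.
rewrite mu_E => H; rewrite -(ler_pM2l muP); apply: (le_trans H).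
have row tau : \sum_tau' pr P (tuple_event tau `&` tuple_event tau') <=
    QT ^+ 2 * \sum_(U : {set 'I_k}) m%:R ^+ (k - #|U|) / Q U.
  under eq_bigr do rewrite pair_E.
  rewrite -mulr_sumr ler_wpM2l ?sqr_ge0//.
  rewrite (partition_big (agree tau) predT)//=; apply: ler_sum => U _.
  rewrite (eq_bigr (fun=> (Q U)^-1)); last by move=> tau' /eqP ->.
  rewrite sumr_const -[X in X <= _]mulr_natl ler_wpM2r//.
    by rewrite invr_ge0 ltW.
  rewrite -natrX ler_nat; apply: leq_trans (count_agree tau U).
  by rewrite cardsE.
have tot : \sum_tau \sum_tau' pr P (tuple_event tau `&` tuple_event tau') <=
    m%:R ^+ k * (QT ^+ 2 * \sum_(U : {set 'I_k}) m%:R ^+ (k - #|U|) / Q U).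
  apply: (le_trans (ler_sum _ (fun tau _ => row tau))).
  by rewrite sumr_const card_ffun !card_ord -natrX -[X in X <= _]mulr_natl.
rewrite lerBlDr; apply: (le_trans tot).
rewrite (bigID (fun U : {set 'I_k} => 0 < #|U|)%N)/= addrC.
rewrite (eq_bigl (pred1 (finset.set0 : {set 'I_k}))); last first.
  by move=> U; rewrite -eqn0Ngt cards_eq0.
rewrite big_pred1_eq cards0 subn0 {1}/Q big1 ?invr1 ?mulr1; last first.
  by move=> p; rewrite !inE.
rewrite !mulrDr addrC lerD//; last first.
  by rewrite le_eqVlt; apply/orP; left; apply/eqP; ring.
rewrite mulrA mulr_sumr [leRHS]mulr_sumr; apply: ler_sum => U U0.
have kU : (#|U| <= k)%N by rewrite -[leqRHS]card_ord max_card.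
rewrite expfB_cond ?kU//; last by rewrite gt_eqF.
rewrite -/(Q U); move: (m%:R ^+ k) (m%:R ^+ #|U|) (Q U) => a b q.
by rewrite le_eqVlt; apply/orP; left; apply/eqP; ring.
Qed.

End BlockTuples.

Lemma entry_pr_lb k (alpha delta : R) : 0 < alpha -> 0 < delta ->
  exists c1, [/\ 0 < c1, c1 <= 1 & forall (c : 'I_k * 'I_k -> R) p, 0 <= c p ->
    c1 * expR (- ((1 + delta) * (c p ^+ 2 / (2 * entry_scale alpha p ^+ 2)))) <=
    entry_pr alpha c p].
Proof.
move=> a0 d0; have [ca ca0 Ha] := normal_prob_tail_lb a0 d0.
have [cb cb0 Hb] := normal_prob_tail_lb ltr01 d0.
exists (Num.min (Num.min ca cb) 1); split.
- by rewrite !lt_min ca0 cb0 ltr01.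
- by rewrite ge_min lexx orbT.
move=> c p c0; rewrite -lee_fin /entry_pr fineK; last first.
  by apply: fin_num_measure; exact: measurable_itv.
rewrite /entry_scale; case: (p.1 == p.2).
  apply: (le_trans _ (Ha _ c0)); rewrite lee_fin ler_wpM2r ?expR_ge0//.
  by rewrite !ge_min lexx.
apply: (le_trans _ (Hb _ c0)); rewrite lee_fin ler_wpM2r ?expR_ge0//.
by rewrite !ge_min lexx orbT.
Qed.

(** Shrinking B by 1 - delta multiplies the energy by (1 - delta)^2, and the tail
    bound costs a factor 1 + delta; as (1 + delta) (1 - delta)^2 <= 1 - delta, the
    pattern on U has probability at least of order n^(- (1 - delta) #|U|). *)
Lemma prod_entry_pr_lb k (alpha delta c1 L l : R) (B : 'M[R]_k) (U : {set 'I_k})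
    (c : 'I_k * 'I_k -> R) :
  0 < alpha -> 0 < delta -> delta < 1 -> 0 < c1 -> c1 <= 1 -> 0 < L -> L ^+ 2 = 2 * l ->
  feasible (alpha ^+ 2) B -> (forall i j, 0 <= B i j) ->
  (forall p, c p = (1 - delta) * B p.1 p.2 * L) ->
  (forall p, 0 <= c p ->
    c1 * expR (- ((1 + delta) * (c p ^+ 2 / (2 * entry_scale alpha p ^+ 2)))) <=
    entry_pr alpha c p) -> (0 < #|U|)%N ->
  c1 ^+ (k * k) * expR (- ((1 - delta) * #|U|%:R * l)) <=
  \prod_(p in upairs U) entry_pr alpha c p.
Proof.
move=> a0 d0 d1 c10 c11 L0 Ll [_ BE] B0 cE lb U0.
have l0 : 0 <= l by have := sqr_ge0 L; rewrite Ll; lra.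
have dB : 0 <= 1 - delta by lra.
apply: (@le_trans _ _ (\prod_(p in upairs U) (c1 *
    expR (- ((1 + delta) * (c p ^+ 2 / (2 * entry_scale alpha p ^+ 2))))))); last first.
  apply: ler_prod => p _; rewrite mulr_ge0 ?expR_ge0 ?(ltW c10)//=; apply: lb.
  by rewrite cE !mulr_ge0// ltW.
rewrite big_split /= prodr_const -expR_sum; apply: ler_pM.
- by rewrite exprn_ge0// ltW.
- exact: expR_ge0.
- have Uk : (#|upairs U| <= k * k)%N.
    by apply: (leq_trans (max_card _)); rewrite card_prod card_ord.
  by rewrite ler_wiXn2l ?(ltW c10).
rewrite ler_expR sumrN lerN2.
have -> : \sum_(p in upairs U) (1 + delta) * (c p ^+ 2 / (2 * entry_scale alpha p ^+ 2)) =
    (1 + delta) * (1 - delta) ^+ 2 * l * energy (alpha ^+ 2) U B.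
  rewrite energyE mulr_sumr; apply: eq_bigr => p _.
  have v0 := entry_scale_gt0 p a0.
  rewrite cE -entry_scale_sqr.
  have -> : ((1 - delta) * B p.1 p.2 * L) ^+ 2 =
    (1 - delta) ^+ 2 * B p.1 p.2 ^+ 2 * (2 * l) by rewrite -Ll; ring.
  by field; rewrite gt_eqF.
have EU := BE U U0; have U1 : 0 <= #|U|%:R :> R by [].
apply: (@le_trans _ _ ((1 + delta) * (1 - delta) ^+ 2 * l * #|U|%:R)).
  by rewrite ler_wpM2l// !mulr_ge0 ?sqr_ge0//; lra.
rewrite mulrAC ler_wpM2r// ler_wpM2r//.
nra.
Qed.

(** Since x and B are nonnegative, it is enough that the entries of some block
    submatrix exceed those of (1 - delta) L B, with L = scale n. By
    pr_no_tuple_event and prod_entry_pr_lb, each nonempty U contributes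
    O(n^(- delta #|U|)) to the probability that no tuple achieves this. *)
Lemma sparse_max_lower (k : nat) (alpha delta : R) (B : 'M[R]_k) (x : 'cV[R]_k) :
  (0 < k)%N -> 0 < alpha -> 0 < delta -> delta < 1 ->
  feasible (alpha ^+ 2) B -> (forall i j, 0 <= B i j) -> (forall i, 0 <= x i 0) ->
  sqnorm x = 1 ->
  exists C : R, forall d (T : measurableType d) (P : probability T R) n
    (A : 'I_n -> 'I_n -> {RV P >-> R}), (k <= n)%N -> (1 < n)%N ->
    gaussian_symmetric alpha A ->
    pr P [set w | sparse_max k (random_matrix A w) <
                  (1 - delta) * quad_form B x * scale R n] <=
    C * expR (- (delta * ln n%:R)).
Proof.
move=> k0 a0 d0 d1 fB B0 x0 x1; have [c1 [c10 c11 lb]] := @entry_pr_lb k _ _ a0 d0.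
have kR : 0 < k%:R :> R by rewrite ltr0n.
pose C0 := (2 * k%:R) ^+ k * (c1 ^+ (k * k))^-1.
have C00 : 0 <= C0.
  by rewrite mulr_ge0 ?exprn_ge0 ?invr_ge0 ?exprn_ge0 ?mulr_ge0 ?ltW.
exists (#|{set 'I_k}|%:R * C0) => d T P n A kn n1 gA.
have lnn : 0 < ln n%:R :> R by exact: ln_nat_gt0.
have nR : 0 < n%:R :> R by rewrite ltr0n ltnW.
have Lp := scale_gt0 R n1; have L2 := scale_sqr R n1.
pose m := (n %/ k)%N; have m0 : (0 < m)%N by rewrite divn_gt0.
have km : (k * m <= n)%N by rewrite mulnC leq_trunc_div.
have mR : 0 < m%:R :> R by rewrite ltr0n.
have mn : n%:R <= 2 * k%:R * m%:R :> R.
  rewrite -!natrM ler_nat; apply: ltnW; apply: (@leq_trans (m.+1 * k)%N).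
    exact: ltn_ceil.
  by rewrite -mulnA [(k * m)%N]mulnC mulnA leq_mul2r mul2n -addnn -addn1 leq_add2l m0 orbT.
pose c (p : 'I_k * 'I_k) := (1 - delta) * B p.1 p.2 * scale R n.
have c_ge0 p : 0 <= c p by rewrite /c !mulr_ge0 ?(ltW Lp)//; lra.
have q0 p : 0 < entry_pr alpha c p.
  by apply: lt_le_trans (lb c p (c_ge0 p)); rewrite mulr_gt0 ?expR_gt0.
pose E := tuple_event A km c.
have mE : measurable [set w | sparse_max k (random_matrix A w) <
    (1 - delta) * quad_form B x * scale R n].
  rewrite -[X in measurable X]setTI -preimage_itvNyo.
  exact: (measurable_sparse_max_random A k0 (ltnW n1)).
apply: (@le_trans _ _ (pr P (\bigcap_tau ~` E tau))).
  apply: le_pr => //.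
    apply: fin_bigcap_measurable => // tau _.
    exact/measurableC/measurable_tuple_event.
  move=> w /= Mw tau _ Ew; move: Mw; apply/negP; rewrite -leNgt.
  pose f i := block_index km i (tau i).
  have finj : injective f by move=> i j /block_index_inj[].
  apply: (le_trans _ (sparse_max_ge_principal _ finj x1)).
  rewrite !quad_formE mulr_sumr mulr_suml; apply: ler_sum => i _.
  rewrite mulr_sumr mulr_suml; apply: ler_sum => j _.
  have entry (i' j' : 'I_k) : (i' <= j')%N -> c (i', j') <= random_matrix A w (f i') (f j').
    move=> ij; have pT : (i', j') \in upairs [set: 'I_k]%SET by rewrite !inE.
    by have := Ew _ pT; rewrite mxE /= in_itv/= andbT.
  have {}entry : c (i, j) <= principal_submx (random_matrix A w) f i j.
    rewrite mxE; have [ij|/ltnW ji] := leqP i j; first exact: entry.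
    have -> : c (i, j) = c (j, i).
      by rewrite /c/=; case: fB => Bsym _; rewrite -{1}Bsym mxE.
    have -> : random_matrix A w (f i) (f j) = random_matrix A w (f j) (f i).
      by rewrite -{1}(random_matrix_sym gA w) mxE.
    exact: entry.
  have -> : (1 - delta) * (x i 0 * B i j * x j 0) * scale R n =
      x i 0 * c (i, j) * x j 0 by rewrite /c/=; ring.
  by rewrite ler_wpM2r// ler_wpM2l.
apply: (le_trans (pr_no_tuple_event gA km m0 q0)).
have -> : #|{set 'I_k}|%:R * C0 * expR (- (delta * ln n%:R)) =
   \sum_(U : {set 'I_k}) C0 * expR (- (delta * ln n%:R)).
  by rewrite sumr_const -[RHS]mulr_natl mulrA.
rewrite big_mkcond /=; apply: ler_sum => U _.
case: ifPn => [U0|_]; last by rewrite mulr_ge0 ?expR_ge0.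
have UR : 1 <= #|U|%:R :> R by rewrite ler1n.
have Uk : (#|U| <= k)%N by rewrite -[leqRHS]card_ord max_card.
have QU := prod_entry_pr_lb a0 d0 d1 c10 c11 Lp L2 fB B0 (fun p => erefl (c p))
  (lb c) U0.
have cK : 0 < c1 ^+ (k * k) by rewrite exprn_gt0.
have mU : (m%:R ^+ #|U|)^-1 <= (2 * k%:R) ^+ k * expR (- (#|U|%:R * ln n%:R)) :> R.
  rewrite expRN expRM_natl lnK ?posrE// ler_pdivlMr ?exprn_gt0// mulrC.
  rewrite ler_pdivrMr ?exprn_gt0//.
  apply: (@le_trans _ _ ((2 * k%:R * m%:R) ^+ #|U|)).
    by rewrite lerXn2r// nnegrE ltW// !mulr_gt0.
  rewrite exprMn ler_wpM2r ?exprn_ge0 ?(ltW mR)// ler_weXn2l//.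
  by rewrite -natrM ler1n muln_gt0.
have Qi : (\prod_(p in upairs U) entry_pr alpha c p)^-1 <=
    (c1 ^+ (k * k))^-1 * expR ((1 - delta) * #|U|%:R * ln n%:R).
  rewrite -[expR _]invrK -expRN -invfM lef_pV2 ?posrE//.
    by rewrite prodr_gt0.
  by rewrite mulr_gt0 ?expR_gt0.
apply: (le_trans (ler_pM _ _ mU Qi)).
- by rewrite invr_ge0 exprn_ge0 ?ltW.
- by rewrite invr_ge0 ltW// prodr_gt0.
rewrite mulrACA -/C0 ler_wpM2l// -expRD ler_expR.
have : 0 <= delta * ln n%:R * (#|U|%:R - 1).
  by rewrite mulr_ge0 ?subr_ge0// mulr_ge0// ltW.
lra.
Qed.

End LowerBound.

(** * Convergence in probability *)

Section Limit.
Variable R : realType.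

Lemma cvg_natpow_neg (c C : R) : 0 < c ->
  (fun n => C * expR (- (c * ln n%:R))) @ \oo --> (0 : R).
Proof.
move=> c0; rewrite -[X in _ --> X](mulr0 C); apply: cvgM; first exact: cvg_cst.
apply/cvgrPdist_lt => e e0; near=> n.
rewrite sub0r normrN ger0_norm ?expR_ge0// -[e]lnK ?posrE// ltr_expR.
have nbig : expR (- ln e / c) < n%:R by near: n; exact: nbhs_infty_gtr.
rewrite ltrNl -ltr_pdivrMl// mulrC -[ltLHS]expRK ltr_ln ?posrE ?expR_gt0//.
by apply: lt_trans nbig; exact: expR_gt0.
Unshelve. all: by end_near. Qed.

Lemma measurable_deviation d (T : measurableType d) (M : T -> R) (L g eps : R) :
  measurable_fun setT M -> measurable [set w | eps <= `|M w / L - g|].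
Proof.
move=> mM; rewrite -[X in measurable X]setTI -preimage_itvcy.
suff mD : measurable_fun setT (fun w => `|M w / L - g|) by exact: mD.
apply: measurableT_comp => //; apply: measurable_funB => //.
exact: measurable_funM.
Qed.

End Limit.

Unset Implicit Arguments.

Theorem theorem1 (R : realType) (k : nat) (alpha : R)
    (d : nat -> measure_display) (T : forall n, measurableType (d n))
    (P : forall n, probability (T n) R)
    (A : forall n, 'I_n -> 'I_n -> {RV (P n) >-> R}) :
  (1 <= k)%N -> 0 < alpha ->
  (forall n, (k <= n)%N -> gaussian_symmetric alpha (A n)) ->
  cvg_in_probability P
    (fun n w => sparse_max k (random_matrix (A n) w) / Num.sqrt (2 * ln n%:R))
    (gamma_max k (alpha ^+ 2)).
Proof.
move=> k0 a0 gA eps eps0; set G := gamma_max k (alpha ^+ 2).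
have a20 : 0 < alpha ^+ 2 by exact: exprn_gt0.
have G0 : 0 <= G by exact: gamma_max_ge0.
pose t := eps / (2 * (G + 1)).
have t0 : 0 < t by rewrite divr_gt0// mulr_gt0//; lra.
have tG : t * G <= eps / 2.
  have -> : eps / 2 = t * (G + 1) by rewrite /t; field; lra.
  by rewrite ler_wpM2l ?(ltW t0)//; lra.
(* This makes delta <= t and delta < 1 for every t > 0. *)
pose delta := t / (1 + t).
have delta0 : 0 < delta by rewrite divr_gt0//; lra.
have delta1 : delta < 1 by rewrite ltr_pdivrMr; lra.
have deltat : delta <= t.
  by rewrite ler_pdivrMr; nra.
have eps20 : 0 < eps / 2 by lra.
have [B [x [fB B0 x0 x1 BG]]] := gamma_max_approx k0 a20 eps20.
have xG : quad_form B x <= G by exact: quad_form_le_gamma.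
have s1 : 1 < 1 + t by lra.
have [C1 up] := sparse_max_upper k0 a0 s1.
have [C2 low] := sparse_max_lower k0 a0 delta0 delta1 fB B0 x0 x1.
apply: (@squeeze_cvge _ _ _ _ (fun=> 0%E) _
  (fun n => (C1 * expR (- (t * ln n%:R)) + C2 * expR (- (delta * ln n%:R)))%:E)).
- near=> n; have kn : (k <= n)%N by near: n; exact: nbhs_infty_ge.
  have n1 : (1 < n)%N by near: n; exact: nbhs_infty_gt.
  rewrite measure_ge0 /=; have Lp := scale_gt0 R n1.
  have gAn := gA n kn.
  have mM := measurable_sparse_max_random (A n) k0 (ltnW n1).
  have mS := measurable_deviation (Num.sqrt (2 * ln n%:R)) G eps mM.
  rewrite prE// lee_fin; pose Eup := [set w | G * ((1 + t) * scale R n) <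
    sparse_max k (random_matrix (A n) w)].
  pose Elow := [set w | sparse_max k (random_matrix (A n) w) <
    (1 - delta) * quad_form B x * scale R n].
  have := up _ _ (P n) n (A n) kn n1 gAn.
  have := low _ _ (P n) n (A n) kn n1 gAn.
  rewrite -/Eup -/Elow (_ : 1 + t - 1 = t); last by ring.
  have mup : measurable Eup.
    by rewrite /Eup -[X in measurable X]setTI -preimage_itvoy; exact: mM.
  have mlow : measurable Elow.
    by rewrite /Elow -[X in measurable X]setTI -preimage_itvNyo; exact: mM.
  move=> lo hi; apply: (@le_trans _ _ (pr (P n) Eup + pr (P n) Elow)).
    have := @pr_union_bound _ _ _ (P n) bool predT _
      (fun b => if b then Eup else Elow) mS.
    rewrite big_bool /=; apply => [[]//|w /= dev].
    move: dev; rewrite -/(scale R n).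
    set M := sparse_max _ _; have [MG|MG] := leP 0 (M / scale R n - G).
      rewrite ger0_norm// => dev; exists true => //; rewrite /Eup /= -/M.
      have : G + eps <= M / scale R n by lra.
      rewrite ler_pdivlMr// => h; apply: lt_le_trans h.
      by rewrite mulrA ltr_pM2r//; lra.
    rewrite ltr0_norm// => dev; exists false => //; rewrite /Elow /= -/M.
    have : M / scale R n <= G - eps by lra.
    rewrite ler_pdivrMr// => h; apply: (le_lt_trans h).
    rewrite ltr_pM2r//.
    have : delta * quad_form B x <= t * G.
      apply: (@le_trans _ _ (delta * G)); first by rewrite ler_wpM2l ?(ltW delta0).
      by rewrite ler_wpM2r.
    move: BG; rewrite -/G; lra.
  exact: lerD.
- exact: cvg_cst.
- apply: cvg_EFin; first by near=> n.
  rewrite -[X in _ --> X]addr0; apply: cvgD; exact: cvg_natpow_neg.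
Unshelve. all: by end_near. Qed.
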